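(* Suppose the victim selects its strategy at each time independently (of time and of the jammer) from a finite set $\mathcal{P}$ according to an unknown distribution $\{p_i\}_{i=1}^{|\mathcal{P}|}$. Then the regret of JB satisfies $$R_n=\mathcal{O}\!\left(N_{mod}\,n^{\frac{\alpha+2}{2(\alpha+1)}}(\log n)^{\frac{\alpha}{2(\alpha+1)}}\right).$$
   Context: Setting: finite set $\boldsymbol{\mathcal{J}}$ of $N_{mod}$ jammer signaling schemes, continuous jammer parameters $\mathbf{s}\in[0,1]^2$. When the victim uses strategy $i\in\mathcal{P}$ and the jammer plays $(\mathcal{J},\mathbf{s})$ at time $t$, the jammer receives reward $C^i_t(\mathcal{J},\mathbf{s})\in[0,1]$, i.i.d. over time with mean $\bar C^i(\mathcal{J},\mathbf{s})$, and each $\bar C^i$ satisfies $|\bar C^i(\mathcal{J},\mathbf{s})-\bar C^i(\mathcal{J},\mathbf{s}')|\le L\|\mathbf{s}-\mathbf{s}'\|^\alpha$ ($L\ge0$, $\alpha\in(0,1]$). The jammer does not observe the victim's strategy. $(\mathcal{J}^*,\mathbf{s}^* )$ maximizes $\sum_i p_i\bar C^i(\mathcal{J},\mathbf{s})$. Regret: $R_n=\mathbf{E}\big[\sum_{t=1}^n\sum_{i=1}^{|\mathcal{P}|}p_i\big(C^i_t(\mathcal{J}^*,\mathbf{s}^* )-C^i_t(\mathcal{J}_t,\mathbf{s}_t)\big)\big]$. JB algorithm: for $T=1,2,4,\dots$ while $T\le n$: set $M=\lceil(\sqrt{T/\log T}L2^{\alpha/2})^{1/(1+\alpha)}\rceil$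 ($M=1$ if $T=1$), start a fresh UCB1 (play each arm once, then play the arm maximizing sample mean $+\sqrt{2\log t/u}$, $u$ = number of plays, $t$ = steps since start) on the arms $\boldsymbol{\mathcal{J}}\times\{1/M,\dots,1\}^2$ and use it for times $T,\dots,\min(2T-1,n)$. The implied constant depends only on $L$ and $\alpha$. *)

(* Defs.v *)
From HB Require Import structures.
From mathcomp Require Import all_boot all_order all_algebra.
From mathcomp Require Import all_classical all_reals all_analysis.
Set Implicit Arguments.
Unset Strict Implicit.
Unset Printing Implicit Defensive.
Import Order.TTheory GRing.Theory Num.Theory.
Import numFieldNormedType.Exports.
Local Open Scope classical_set_scope.
Local Open Scope ring_scope.

Section JB.
Variable R : realType.

Definition unit_box (s : R * R) : Prop :=
  0 <= s.1 <= 1 /\ 0 <= s.2 <= 1.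

Definition dist2 (s s' : R * R) : R :=
  Num.sqrt ((s.1 - s'.1) ^+ 2 + (s.2 - s'.2) ^+ 2).

(* Parameter M of the JB epoch starting at time T
   (M = 1 for T = 1; max 1 _ guards the degenerate case L = 0). *)
Definition JB_M (L alpha : R) (T : nat) : nat :=
  if T == 1%N then 1%N
  else maxn 1 (absz (Num.ceil
     ((Num.sqrt (T%:R / ln T%:R) * L * powR 2 (alpha / 2))
        `^ (1 / (1 + alpha))))).

Variable J : finType. (* jammer signaling schemes, N_mod = #|J| *)

(* Arms of UCB1 with grid parameter M: indices k < #|J| * M * M,
   k encodes (j, (a+1)/M, (b+1)/M) with j = (enum J)_(k / M^2),
   a = (k mod M^2) / M, b = k mod M. None never occurs for valid k. *)
Definition grid_arm (M k : nat) : option (J * (R * R)) :=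
  omap (fun j => (j, ((((k %% (M * M)) %/ M).+1)%:R / M%:R,
                      ((k %% M).+1)%:R / M%:R)))
       (nth None [seq Some x | x <- enum J] (k %/ (M * M))).

Definition nb_arms (M : nat) : nat := (#|J| * M * M)%N.

(* UCB1 on arms 0..K-1 given the observations (arm, reward) since the
   start of the current UCB1 instance: first play each arm once (in
   order), then play the arm maximizing mean + sqrt(2 log t / u), where
   t is the number of steps since start and u the number of plays of the
   arm; ties broken in favour of the smallest arm index. *)
Definition ucb_index (obs : seq (nat * R)) (k : nat) : R :=
  let u := count (fun o => o.1 == k) obs in
  (\sum_(o <- obs | o.1 == k) o.2) / u%:R
  + Num.sqrt (2 * ln (size obs)%:R / u%:R).

Definition ucb_choice (M : nat) (obs : seq (nat * R)) : nat :=
  let K := nb_arms M in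
  if (size obs < K)%N then size obs
  else foldl (fun b k => if ucb_index obs b < ucb_index obs k then k else b)
             0%N (iota 0 K).

Variable P : finType. (* victim strategies *)
Variables (d : measure_display) (Omega : measurableType d).
Variable V : nat -> Omega -> P.            (* victim strategy at time t *)
Variable C : nat -> P -> J -> R * R -> Omega -> R.
  (* C t i j s : reward of the jammer at time t for (j,s) when victim plays i *)
Variables (L alpha : R).

Definition obs_reward (t : nat) (a : option (J * (R * R))) (w : Omega) : R :=
  if a is Some (j, s) then C t (V t w) j s w else 0.

Fixpoint epoch_hist (T k : nat) (w : Omega) : seq (nat * R) :=
  if k is k'.+1 then
    let h := epoch_hist T k' w in
    let a := ucb_choice (JB_M L alpha T) h in
    rcons h (a, obs_reward (T + k') (grid_arm (JB_M L alpha T) a) w)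
  else [::].

Definition JB_play (t : nat) (w : Omega) : option (J * (R * R)) :=
  let T := (2 ^ trunc_log 2 t)%N in
  let M := JB_M L alpha T in
  grid_arm M (ucb_choice M (epoch_hist T (t - T) w)).

Variable p : P -> R.

Definition sigma_V (t : nat) : set (set Omega) :=
  [set (V t) @^-1` B | B in [set: set P]].

Definition sigma_C (t : nat) : set (set Omega) :=
  <<s [set A | exists i j s (B : set R),
          [/\ unit_box s, measurable B & A = C t i j s @^-1` B]] >>.

Definition time_blocks (x : nat + nat) : set (set Omega) :=
  match x with inl u => sigma_V u.+1 | inr u => sigma_C u.+1 end.

Definition JB_regret_integrand (n : nat) (jstar : J) (sstar : R * R)
  (w : Omega) : R :=
  \sum_(1 <= t < n.+1) \sum_(i : P)
     p i * (C t i jstar sstar w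
            - (if JB_play t w is Some (j, s) then C t i j s w else 0)).

End JB.

Section Indep.
Variables (R : realType) (d : measure_display) (Omega : measurableType d).
Variable Pr : probability Omega R.

Definition prob (A : set Omega) : R := fine (Pr A).

Definition mutually_independent (I : eqType) (F : I -> set (set Omega))
  : Prop :=
  forall (s : seq I) (E : I -> set Omega), uniq s ->
    (forall i, i \in s -> F i (E i)) ->
    prob (\big[setI/setT]_(i <- s) E i) = \prod_(i <- s) prob (E i).
End Indep.

(* Main.v *)
Require Import Defs.
From HB Require Import structures.
From mathcomp Require Import all_boot all_order all_algebra.
From mathcomp Require Import all_classical all_reals all_analysis.
From mathcomp Require Import measurable_realfun.
From mathcomp Require Import ring lra.
Set Implicit Arguments.
Unset Strict Implicit.
Unset Printing Implicit Defensive.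
Import Order.TTheory GRing.Theory Num.Theory.
Import numFieldNormedType.Exports.
Local Open Scope classical_set_scope.
Local Open Scope ring_scope.

(** A deviation of an arm's empirical mean is controlled by an exponential
    supermartingale: at each step the arm to be played depends only on the past,
    which is independent of the current rewards, so
    [exp (l (S - mu N) - l^2 N / 8)] has expectation at most 1 by Hoeffding's
    lemma ([N] plays of total reward [S]).  Taking a union bound over the possible
    values of [N], with [l] tuned to each, all confidence intervals of UCB1 hold at
    step [t >= K] outside an event of probability at most [2 K t^-3 <= 2 t^-2].
    When they hold, the regret of the step is at most
    [2 sqrt (2 ln T / N)], and summing [N ^ (-1/2)] over the plays of each arm gives
    [O(sqrt (K T ln T))] for an epoch of length [T] with [K] arms.  With
    [K = N_mod M^2] and the discretization error [T L (sqrt 2 / M)^alpha], the choice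
    of [M] balances both terms, and the epoch bounds grow geometrically. *)

(** * Hoeffding's lemma *)

(** The victim's hidden randomization is absorbed into the noise: [V t] is independent of the
    rewards at time [t], so the observed reward of an arm has the [p]-average of the means [Cbar i]
    as its mean, and UCB1 faces an ordinary stochastic bandit. The regret compares rewards averaged
    over all strategies; since the arm played is a function of the past, its expectation is that of
    the gap between these averaged means. Nothing bounds the gaps between arms from below on a grid
    that gets finer with [T], so the logarithmic regret bound, with gaps in the denominator, is of
    no use. The bound is therefore gap-free and holds against an arbitrary competing arm, later
    taken to be a grid point near the optimum. The number of plays of an arm depends on the rewards
    it gave, which rules out a concentration inequality for samples of fixed size. Two regimes are
    treated apart: for [K > T] the additive [K] spent on trying every arm once is too large, but the
    trivial bound [T] is then below [sqrt (K T)]; for [T = 1] the logarithm vanishes and the single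
    step costs at most 1. *)

Lemma bernoulli_mgf_le (R : realType) (m l : R) : 0 <= m <= 1 -> 0 <= l ->
  1 - m + m * expR l <= expR (l * m + l ^+ 2 / 8).
Proof.
move=> /andP[m0 m1] l0.
pose q : R -> R := fun x => 1 - m + m * expR x.
have q0 x : 0 < q x.
  have := expR_gt0 x; rewrite /q => e0.
  have [->|mne] := eqVneq m 0; first by rewrite mul0r subr0 addr0.
  have := mulr_gt0 (_ : 0 < m) e0; rewrite lt_def mne m0 /= => /(_ isT); lra.
have dq (x : R) : is_derive x (1 : R) q (m * expR x).
  by rewrite /q; apply: is_derive_eq; rewrite add0r mul1r.
(* [h] is the derivative of the gap [g] below between the logarithms of both sides. Its own
   derivative is 1/4 minus the variance of the Bernoulli law tilted by [expR x], hence nonnegative;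
   [g] and [h] vanish at 0. *)
pose h : R -> R := fun x => m + x / 4 - m * expR x / q x.
have dh (x : R) : is_derive x (1 : R) h (1 / 4 - m * (1 - m) * expR x / q x ^+ 2).
  rewrite /h; have := lt0r_neq0 (q0 x) => qx0; apply: is_derive_eq.
  by rewrite /GRing.scale /= /q; move: qx0; rewrite /q => qx0; field.
have h0 x : 0 <= x -> 0 <= h x.
  move=> x0; have -> : 0 = h 0.
    by rewrite /h /q expR0 mulr1 subrK mul0r addr0 divr1 subrr.
  apply: (@ger0_derive1_ndecry _ h 0) => // [y _|].
  - rewrite derive1E (@derive_val _ _ _ _ _ _ _ (dh y)) subr_ge0 ler_pdivrMr ?exprn_gt0 //.
    rewrite /q; set e := expR y.
    have := sqr_ge0 (1 - m - m * e); nra.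
  - by apply: derivable_within_continuous => y _; exact: ex_derive.
pose g : R -> R := fun x => x * m + x ^+ 2 / 8 - ln (q x).
have dg (x : R) : is_derive x (1 : R) g (h x).
  have dlq : is_derive x (1 : R) (@ln R \o q) ((q x)^-1 * (m * expR x)).
    exact: is_derive1_comp (is_derive1_ln (q0 x)) (dq x).
  rewrite /g; apply: is_derive_eq.
  by rewrite /GRing.scale /= /h; field; rewrite lt0r_neq0.
have : 0 <= g l.
  have -> : 0 = g 0.
    by rewrite /g /q expR0 mulr1 subrK ln1 mul0r expr0n mul0r addr0 subr0.
  apply: (@ger0_derive1_ndecry _ g 0) => // [y|].
  - by rewrite in_itv /= andbT => /ltW y0; rewrite derive1E (@derive_val _ _ _ _ _ _ _ (dg y)) h0.
  - by apply: derivable_within_continuous => y _; exact: ex_derive.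
rewrite /g subr_ge0 => gl; rewrite -[leLHS]lnK ?posrE ?q0 //.
by rewrite ler_expR.
Qed.

Lemma expR_le_chord (R : realType) (l x : R) : 0 <= x <= 1 ->
  expR (l * x) <= 1 - x + x * expR l.
Proof.
move=> /andP[x0 x1].
have := @convex_expR R (Itv01 x0 x1) l 0.
by rewrite !convRE /= expR0 mulr0 addr0 mulr1 addrC mulrC.
Qed.

(** By convexity, among variables in [0,1] of mean [m] the Bernoulli one has the largest exponential
    moment. *)
Lemma hoeffding_mgf (R : realType) d (Omega : measurableType d)
  (Pr : probability Omega R) (X : Omega -> R) (m l : R) :
  measurable_fun setT X -> (forall w, 0 <= X w <= 1) ->
  (\int[Pr]_w (X w)%:E = m%:E)%E -> 0 <= l ->
  (\int[Pr]_w (expR (l * (X w - m)))%:E <= (expR (l ^+ 2 / 8))%:E)%E.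
Proof.
move=> mX X01 Xm l0.
have cint (c : R) : (\int[Pr]_w c%:E = c%:E)%E.
  by rewrite integral_cst //= probability_setT mule1.
have m01 : 0 <= m <= 1.
  rewrite -!lee_fin -Xm integral_ge0 /=; last first.
    by move=> w _; rewrite lee_fin; case/andP: (X01 w).
  rewrite -(cint 1); apply: ge0_le_integral => //.
  - by move=> w _; rewrite lee_fin; case/andP: (X01 w).
  - exact/measurable_EFinP.
  - by move=> w _; rewrite lee_fin; case/andP: (X01 w).
have e1 : 0 <= expR l - 1 by rewrite subr_ge0 -expR0 ler_expR.
pose c := expR (- (l * m)).
have c0 : 0 <= c by exact: expR_ge0.
apply: (@le_trans _ _ (\int[Pr]_w (c * (1 + (expR l - 1) * X w))%:E)%E).
  apply: ge0_le_integral => //.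
  - apply/measurable_EFinP; apply: measurableT_comp => //.
    by apply: measurable_funM => //; apply: measurable_funB.
  - apply/measurable_EFinP; apply: measurable_funM => //.
    by apply: measurable_funD => //; apply: measurable_funM.
  - move=> w _; rewrite lee_fin mulrBr addrC expRD ler_wpM2l //.
    apply: le_trans (expR_le_chord l (X01 w)) _.
    by rewrite le_eqVlt; apply/orP; left; apply/eqP; ring.
have mEX : measurable_fun setT (fun w => ((expR l - 1)%:E * (X w)%:E)%E).
  by apply/measurable_EFinP; apply: measurable_funM.
have EX0 w : [set: Omega] w -> (0 <= (expR l - 1)%:E * (X w)%:E)%E.
  by move=> _; rewrite mule_ge0 // lee_fin //; case/andP: (X01 w).
have -> : (\int[Pr]_w (c * (1 + (expR l - 1) * X w))%:E =
    \int[Pr]_w (c%:E * (1%:E + (expR l - 1)%:E * (X w)%:E)))%E by [].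
rewrite ge0_integralZl_EFin //; last 2 first.
- by move=> w _; rewrite adde_ge0 // EX0.
- exact: emeasurable_funD.
rewrite ge0_integralD // ge0_integralZl_EFin //; last 2 first.
- by move=> w _; rewrite lee_fin; case/andP: (X01 w).
- exact/measurable_EFinP.
rewrite cint Xm -[leLHS]/((c * (1 + (expR l - 1) * m))%:E) lee_fin.
have := bernoulli_mgf_le m01 l0.
rewrite expRD -ler_pdivrMl ?expR_gt0 // -expRN; apply: le_trans.
by rewrite /c le_eqVlt; apply/orP; left; apply/eqP; ring.
Qed.

(** * Independent set systems *)

Section Independence.
Context d (Omega : measurableType d) (R : realType) (Pr : probability Omega R).

Definition indep_sys (F G : set (set Omega)) :=
  forall A B, F A -> G B -> Pr (A `&` B) = (Pr A * Pr B)%E.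

Lemma indep_sysC F G : indep_sys F G -> indep_sys G F.
Proof. by move=> FG A B GA FB; rewrite setIC FG // muleC. Qed.

(** Dynkin's pi-lambda argument: for fixed [B], the sets [A] satisfying the product rule form a
    Dynkin system. Measurability is kept in the predicate because the complement and union steps use
    it. *)
Lemma indep_sys_sigmal F G : F `<=` measurable -> G `<=` measurable ->
  setI_closed F -> indep_sys F G -> indep_sys <<s F >> G.
Proof.
move=> mF mG FI FG A B + GB.
have mB := mG _ GB.
rewrite -(setI_closed_g_dynkin_g_sigma_algebra FI) => FA.
suff [] : measurable A /\ Pr (A `&` B) = (Pr A * Pr B)%E by [].
move: A FA; apply: smallest_sub => [|A FA]; last by split; [exact: mF|exact: FG].
split => [|A [mA AB]|H tH HH].
- by split=> //; rewrite setTI probability_setT mul1e.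
- split; first exact: measurableC.
  rewrite setIC -setDE measureD //=; last by rewrite -ge0_fin_numE // fin_num_measure.
  rewrite setIC AB probability_setC //.
  have : Pr A \is a fin_num by rewrite fin_num_measure.
  have : Pr B \is a fin_num by rewrite fin_num_measure.
  case: (Pr A) => // a; case: (Pr B) => // b _ _.
  transitivity ((b - a * b)%:E) => //; transitivity (((1 - a) * b)%:E) => //.
  by rewrite mulrBl mul1r.
- have mH k : measurable (H k) by have [] := HH k.
  split; first exact: bigcup_measurable.
  rewrite setI_bigcupl measure_bigcup //; last 2 first.
  + by move=> k _; exact: measurableI.
  + exact: trivIset_setIr.
  rewrite measure_bigcup //.
  have : Pr B \is a fin_num by rewrite fin_num_measure.
  case: (Pr B) HH => // b HH _.
  rewrite muleC -nneseriesZl //; apply: eq_eseriesr => k _.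
  by rewrite [RHS]muleC; exact: (HH k).2.
Qed.

(** The joint law of [(Z, Y)] agrees with the product of the marginal laws on rectangles, hence
    everywhere; Tonelli then factors the integral. *)
Lemma indep_expectation F G (Z Y : Omega -> R) : indep_sys F G ->
  measurable_fun setT Z -> measurable_fun setT Y ->
  (forall B, measurable B -> F (Z @^-1` B)) ->
  (forall B, measurable B -> G (Y @^-1` B)) ->
  (forall w, 0 <= Z w) -> (forall w, 0 <= Y w) ->
  (\int[Pr]_w (Z w * Y w)%:E = (\int[Pr]_w (Z w)%:E) * (\int[Pr]_w (Y w)%:E))%E.
Proof.
move=> FG mZ mY FZ GY Z0 Y0.
pose rZ : {RV Pr >-> R} := HB.pack Z (isMeasurableFun.Build _ _ _ _ _ mZ).
pose rY : {RV Pr >-> R} := HB.pack Y (isMeasurableFun.Build _ _ _ _ _ mY).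
pose ZY w := (Z w, Y w).
have mZY : measurable_fun setT ZY by exact: measurable_fun_pair.
pose rZY : {RV Pr >-> (R * R)%type} := HB.pack ZY (isMeasurableFun.Build _ _ _ _ _ mZY).
have E := @product_measure_unique _ _ _ _ _ (distribution Pr rZ) (distribution Pr rY)
   (distribution Pr rZY).
have {}E X : measurable X ->
    ((distribution Pr rZ) \x (distribution Pr rY))%E X = distribution Pr rZY X.
  apply: E => A B mA mB; rewrite /distribution /pushforward -FG; [|exact: FZ|exact: GY].
  by congr (Pr _); apply/seteqP; split.
(* The absolute values make [f] nonnegative on the whole plane, as Tonelli requires; they change
   nothing on the values of [Z] and [Y]. *)
pose f : R * R -> \bar R := fun z => (`|z.1| * `|z.2|)%:E.
have mf : measurable_fun setT f.
  apply/measurable_EFinP; apply: measurable_funM; apply: measurableT_comp => //.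
have f0 z : (0 <= f z)%E by rewrite lee_fin mulr_ge0.
have mn : measurable_fun setT (fun x : R => (`|x|)%:E).
  exact/measurable_EFinP.
have := @fubini_tonelli1 _ _ _ _ _ (distribution Pr rZ) (distribution Pr rY) f mf f0.
rewrite (eq_measure_integral (distribution Pr rZY)); last by move=> X mX _; exact: E.
rewrite ge0_integral_distribution //.
under eq_integral do rewrite /f /= !ger0_norm //.
move=> ->.
rewrite /fubini_F /f /=.
under eq_integral.
  move=> x _; under eq_integral do rewrite EFinM.
  rewrite ge0_integralZl_EFin // ge0_integral_distribution //.
  under eq_integral do rewrite /= ger0_norm //.
  rewrite muleC.
  over.
rewrite ge0_integralZl //; last by apply: integral_ge0 => w _; rewrite lee_fin.
rewrite ge0_integral_distribution // muleC; congr (_ * _)%E.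
by apply: eq_integral => w _; rewrite /= ger0_norm.
Qed.
End Independence.

(** * UCB1 along a fixed reward sequence *)

Section UCBPath.
Variables (R : realType) (J : finType) (M : nat) (x : nat -> nat -> R).
Let K := nb_arms J M.

(** UCB1 run on a deterministic table: [x u a] is what arm [a] pays if played at step [u]. Rows are
    times rather than play counts, so that a row can later be a random reward independent of the
    past. *)
Fixpoint ucb_hist (k : nat) : seq (nat * R) :=
  if k is k'.+1 then
    let h := ucb_hist k' in
    let a := ucb_choice J M h in
    rcons h (a, x k' a)
  else [::].

Definition ucb_arm k := ucb_choice J M (ucb_hist k).
Definition ucb_count k a := count (fun o => o.1 == a) (ucb_hist k).
Definition ucb_sum k a := \sum_(o <- ucb_hist k | o.1 == a) o.2.

Lemma size_ucb_hist k : size (ucb_hist k) = k.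
Proof. by elim: k => //= k IH; rewrite size_rcons IH. Qed.

Lemma ucb_countS k a : ucb_count k.+1 a = (ucb_count k a + (ucb_arm k == a))%N.
Proof. by rewrite /ucb_count /= -cats1 count_cat /= addn0. Qed.

Lemma ucb_sumS k a :
  ucb_sum k.+1 a = ucb_sum k a + (if ucb_arm k == a then x k a else 0).
Proof.
rewrite /ucb_sum /= -cats1 big_cat /= big_cons big_nil /= -/(ucb_arm k).
by case: eqP => [->|]; rewrite ?addr0.
Qed.

Definition argmax_step (f : nat -> R) b k := if f b < f k then k else b.

Lemma ucb_armE k : ucb_arm k =
  if (k < K)%N then k
  else foldl (argmax_step (ucb_index (ucb_hist k))) 0%N (iota 0 K).
Proof. by rewrite /ucb_arm /ucb_choice size_ucb_hist. Qed.

Lemma foldl_argmax_mem f b s : foldl (argmax_step f) b s \in b :: s.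
Proof.
elim: s b => [|k s IH] b /=; first exact: mem_head.
have := IH (argmax_step f b k); rewrite !inE /argmax_step.
by case: ifP => _ /orP[->|->]; rewrite ?orbT.
Qed.

Lemma foldl_argmax_ge f b s k :
  k \in b :: s -> f k <= f (foldl (argmax_step f) b s).
Proof.
elim: s b k => [|j s IH] b k /=; first by rewrite inE => /eqP ->.
have bj : f b <= f (argmax_step f b j) /\ f j <= f (argmax_step f b j).
  by rewrite /argmax_step; case: ltP => [/ltW|].
rewrite !inE => /or3P[/eqP ->|/eqP ->|ks].
- by apply: le_trans bj.1 (IH _ _ (mem_head _ _)).
- by apply: le_trans bj.2 (IH _ _ (mem_head _ _)).
- by apply: IH; rewrite inE ks orbT.
Qed.

Hypothesis K0 : (0 < K)%N.

Lemma ucb_arm_lt k : (ucb_arm k < K)%N.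
Proof.
rewrite ucb_armE; case: ifP => // _.
have := foldl_argmax_mem (ucb_index (ucb_hist k)) 0%N (iota 0 K).
by rewrite inE mem_iota add0n => /orP[/eqP ->|/andP[]].
Qed.

Lemma ucb_arm_max k a : (K <= k)%N -> (a < K)%N ->
  ucb_index (ucb_hist k) a <= ucb_index (ucb_hist k) (ucb_arm k).
Proof.
move=> Kk aK; rewrite ucb_armE ltnNge Kk /=.
by apply: foldl_argmax_ge; rewrite inE mem_iota add0n aK orbT.
Qed.

Lemma ucb_count_le k a : (ucb_count k a <= k)%N.
Proof. by rewrite /ucb_count -{2}(size_ucb_hist k) count_size. Qed.

Lemma ucb_count_gt0 k a : (K <= k)%N -> (a < K)%N -> (0 < ucb_count k a)%N.
Proof.
move=> Kk aK; have ak : (a < k)%N by exact: leq_trans Kk.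
elim: k ak {Kk} => // k IH; rewrite ltnS leq_eqVlt ucb_countS => /orP[/eqP <-|/IH].
  by rewrite ucb_armE aK eqxx addn1.
by move=> h; rewrite ltn_addr.
Qed.

Lemma sum_ucb_count k : (\sum_(a < K) ucb_count k a = k)%N.
Proof.
elim: k => [|k IH]; first by rewrite big1.
under eq_bigr do rewrite ucb_countS.
rewrite big_split /= IH (bigD1 (Ordinal (ucb_arm_lt k))) //= eqxx big1 ?addn1 //.
by move=> i; rewrite -val_eqE /= eq_sym => /negbTE ->.
Qed.

(* Every play of an arm raises the potential [3 * sqrt count] of that arm by at
   least the corresponding summand. *)
Lemma sum_rsqrt_count_le m :
  \sum_(K <= t < m) (Num.sqrt (ucb_count t (ucb_arm t))%:R)^-1
  <= 3 * \sum_(a < K) Num.sqrt (ucb_count m a)%:R :> R.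
Proof.
elim: m => [|m IH].
  by rewrite big_geq // mulr_ge0 // sumr_ge0 // => a _; exact: sqrtr_ge0.
have [mK|Km] := ltnP m K.
  by rewrite big_geq // mulr_ge0 // sumr_ge0 // => a _; exact: sqrtr_ge0.
rewrite big_nat_recr //=; set i := Ordinal (ucb_arm_lt m).
rewrite (bigD1 i) //=; rewrite (bigD1 i) //= in IH.
rewrite ucb_countS eqxx.
under [X in 3 * (_ + X)]eq_bigr => j ji.
  rewrite ucb_countS eq_sym -[ucb_arm m]/(val i) val_eqE (negbTE ji) addn0.
  over.
apply: le_trans (lerD IH (lexx _)) _.
rewrite -/(nat_of_ord i) [ucb_arm m]/(nat_of_ord i).
have n0 : (0 < ucb_count m i)%N by rewrite ucb_count_gt0 ?ucb_arm_lt.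
set n := ucb_count m i in n0 *; set rest := \sum_(_ < _ | _) _.
suff : (Num.sqrt n%:R)^-1 <= 3 * (Num.sqrt (n + 1)%:R - Num.sqrt n%:R) :> R by lra.
have s0 : 0 < Num.sqrt n%:R :> R by rewrite sqrtr_gt0 ltr0n.
have s2 : Num.sqrt n%:R ^+ 2 = n%:R :> R by rewrite sqr_sqrtr.
have t2 : Num.sqrt (n + 1)%:R ^+ 2 = n%:R + 1 :> R by rewrite sqr_sqrtr // natrD.
have t0 : 0 <= Num.sqrt (n + 1)%:R :> R by exact: sqrtr_ge0.
have n1 : 1 <= n%:R :> R by rewrite ler1n.
rewrite -div1r ler_pdivrMr //.
set s := Num.sqrt n%:R in s0 s2 *; set t := Num.sqrt _ in t2 t0 *.
(* Origin of the constant 3: [n >= 1] gives [t <= 2 * s], so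
   [t - s = 1 / (t + s) >= 1 / (3 * s)]. *)
have t2s : t <= 2 * s by rewrite -(ler_pXn2r (n := 2)) ?nnegrE // ?exprMn ?s2 ?t2; nra.
have ts : s < t by rewrite -(ltr_pXn2r (n := 2)) ?nnegrE // ?s2 ?t2; [lra|exact: ltW].
have e : (t - s) * (t + s) = 1 by rewrite -subr_sqr t2 s2; ring.
nra.
Qed.

(** Cauchy-Schwarz, as the counts sum to [m]. It is proved termwise from
    [sqrt n <= (n * r + 1 / r) / 2], where [r = K / c] makes equality occur at equal counts
    [n = m / K]. *)
Lemma sum_sqrt_count_le m :
  \sum_(a < K) Num.sqrt (ucb_count m a)%:R <= Num.sqrt (K%:R * m%:R) :> R.
Proof.
have Kr : 0 < K%:R :> R by rewrite ltr0n.
case: m => [|m].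
  by rewrite big1 ?mulr0 ?sqrtr0 // => a _; rewrite sqrtr0.
have mr : 0 < m.+1%:R :> R by rewrite ltr0n.
pose c : R := Num.sqrt (K%:R * m.+1%:R).
have c0 : 0 < c by rewrite sqrtr_gt0 mulr_gt0.
have c2 : c ^+ 2 = K%:R * m.+1%:R by rewrite sqr_sqrtr // mulr_ge0 // ltW.
have bnd (a : 'I_K) : Num.sqrt (ucb_count m.+1 a)%:R <=
    ((ucb_count m.+1 a)%:R * (K%:R / c) + c / K%:R) / 2 :> R.
  set n : R := _%:R; have n0 : 0 <= n by exact: ler0n.
  set r := K%:R / c; have r0 : 0 < r by rewrite divr_gt0.
  have -> : c / K%:R = r^-1 by rewrite invf_div.
  have := sqr_ge0 (Num.sqrt n * r - 1); have := sqr_sqrtr n0.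
  have : r * r^-1 = 1 by rewrite divff // lt0r_neq0.
  have : 0 < r^-1 by rewrite invr_gt0.
  set s := Num.sqrt n; set q := r^-1 => q0 rq s2 sr.
  have : 0 <= q * (s * r - 1) ^+ 2 by rewrite mulr_ge0 // ltW.
  have -> : q * (s * r - 1) ^+ 2 = s ^+ 2 * r * (r * q) - 2 * s * (r * q) + q by ring.
  by rewrite rq s2; lra.
apply: le_trans (ler_sum _ (fun a _ => bnd a)) _.
rewrite -mulr_suml big_split /= -mulr_suml -natr_sum sum_ucb_count.
rewrite sumr_const card_ord -[(c / _) *+ K]mulr_natl -/c.
have -> : m.+1%:R * (K%:R / c) = c.
  by rewrite mulrA [_ * K%:R]mulrC -c2 expr2 mulfK // lt0r_neq0.
rewrite mulrCA divff ?mulr1 ?lt0r_neq0 //; lra.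
Qed.

(** Failure of some confidence interval, multiplied through by the number of plays; this is the form
    that appears in the exponent of the supermartingale. *)
Definition ucb_bad (mu : nat -> R) t := [exists a : 'I_K,
  Num.sqrt (2 * ln t%:R * (ucb_count t a)%:R) <
    `|ucb_sum t a - mu a * (ucb_count t a)%:R| ].

(** The index of the arm played is at least that of [k], which is at least [mu k], and exceeds the
    mean of the arm played by at most twice its confidence radius. The competitor [k] is any arm, so
    no gap enters. *)
Lemma ucb_good_regret mu k t T : (K <= t <= T)%N -> (k < K)%N -> ~~ ucb_bad mu t ->
  mu k - mu (ucb_arm t) <=
  2 * Num.sqrt (2 * ln T%:R) * (Num.sqrt (ucb_count t (ucb_arm t))%:R)^-1.
Proof.
move=> /andP[Kt tT] kK /existsPn good.
have t0 : (0 < t)%N by exact: leq_trans Kt.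
have lt0 : 0 <= ln t%:R :> R by rewrite ln_ge0 // ler1n.
have dev a : (a < K)%N ->
    `|ucb_sum t a / (ucb_count t a)%:R - mu a| <=
    Num.sqrt (2 * ln (size (ucb_hist t))%:R / (ucb_count t a)%:R).
  move=> aK; have := good (Ordinal aK); rewrite -leNgt /= size_ucb_hist.
  have n0 : 0 < (ucb_count t a)%:R :> R by rewrite ltr0n ucb_count_gt0.
  set n : R := (ucb_count t a)%:R in n0 *.
  have -> : ucb_sum t a / n - mu a = (ucb_sum t a - mu a * n) / n.
    by rewrite mulrBl mulfK // lt0r_neq0.
  rewrite normrM normfV (gtr0_norm n0) ler_pdivrMr // => h.
  apply: le_trans h _; rewrite -{3}(ger0_norm (ltW n0)) -sqrtr_sqr -sqrtrM.
    by rewrite expr2 mulrA mulfVK // lt0r_neq0.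
  by rewrite divr_ge0 ?mulr_ge0 // ltW.
have := dev _ kK; have := dev _ (ucb_arm_lt t); have := ucb_arm_max Kt kK.
rewrite /ucb_index -/(ucb_count t k) -/(ucb_count t (ucb_arm t)).
rewrite -/(ucb_sum t k) -/(ucb_sum t (ucb_arm t)) !ler_norml.
set c := Num.sqrt (_ / (ucb_count t (ucb_arm t))%:R).
move=> h1 /andP[h2 h2'] /andP[h3 h3'].
have cle : c <= Num.sqrt (2 * ln T%:R) * (Num.sqrt (ucb_count t (ucb_arm t))%:R)^-1.
  rewrite /c size_ucb_hist -sqrtrV // -sqrtrM ?mulr_ge0 ?ln_ge0 ?ler1n ?(leq_trans t0) //.
  rewrite ler_wsqrtr // ler_wpM2r ?invr_ge0 // ler_wpM2l //.
  by rewrite ler_ln ?posrE ?ltr0n ?ler_nat // (leq_trans t0).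
rewrite -mulrA; move: h1 h2 h2' h3 h3' cle.
set v := Num.sqrt (2 * ln T%:R) * _; set b := Num.sqrt (_ / (ucb_count t k)%:R).
set p := _ / (ucb_count t k)%:R; set q := _ / (ucb_count t _)%:R; lra.
Qed.

(** The [K] initial steps and the bad steps are charged 1 each. The constant 6 is 2 from the
    confidence width times 3 from the potential. Keeping [m] apart from [T] allows for an epoch cut
    short by the horizon. *)
Lemma ucb_path_regret mu k m T : (m <= T)%N -> (0 < T)%N -> (k < K)%N ->
  (forall a, (a < K)%N -> 0 <= mu a <= 1) ->
  \sum_(0 <= t < m) (mu k - mu (ucb_arm t)) <=
  K%:R + 6 * Num.sqrt (2 * ln T%:R) * Num.sqrt (K%:R * m%:R)
  + \sum_(K <= t < m) (ucb_bad mu t)%:R.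
Proof.
move=> mT T0 kK mu01.
have le1 t : mu k - mu (ucb_arm t) <= 1.
  by have := mu01 _ kK; have := mu01 _ (ucb_arm_lt t); lra.
have S0 : 0 <= \sum_(K <= t < m) (ucb_bad mu t)%:R :> R by exact: sumr_ge0.
have Q0 : 0 <= 6 * Num.sqrt (2 * ln T%:R) * Num.sqrt (K%:R * m%:R) :> R.
  by apply: mulr_ge0 => //; apply: mulr_ge0.
have first n : \sum_(0 <= t < n) (mu k - mu (ucb_arm t)) <= n%:R.
  apply: le_trans (ler_sum _ (fun t _ => le1 t)) _.
  by rewrite big_const_nat subn0 iter_addr addr0.
have [mK|Km] := ltnP m K.
  have mKr : m%:R <= K%:R :> R by rewrite ler_nat ltnW.
  by have := first m; lra.
rewrite (@big_cat_nat _ _ _ K) //= -addrA; apply: lerD; first exact: first.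
apply: (@le_trans _ _ (\sum_(K <= t < m)
  (2 * Num.sqrt (2 * ln T%:R) * (Num.sqrt (ucb_count t (ucb_arm t))%:R)^-1
   + (ucb_bad mu t)%:R))).
  rewrite big_nat [leRHS]big_nat; apply: ler_sum => t /andP[Kt tm].
  case: (boolP (ucb_bad mu t)) => [_|bt].
    by apply: le_trans (le1 t) _; rewrite lerDr !mulr_ge0 ?invr_ge0 ?sqrtr_ge0.
  by rewrite addr0 ucb_good_regret // Kt (leq_trans (ltnW tm)).
rewrite big_split /= lerD2r -mulr_sumr.
have BA := le_trans (sum_rsqrt_count_le m)
  (ler_wpM2l (ler0n R 3) (sum_sqrt_count_le m)).
have L0 : 0 <= 2 * Num.sqrt (2 * ln T%:R) :> R by rewrite mulr_ge0 // sqrtr_ge0.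
by apply: le_trans (ler_wpM2l L0 BA) _; rewrite le_eqVlt; apply/orP; left; apply/eqP; ring.
Qed.

End UCBPath.

(** * Expected regret of UCB1 *)

Section UCBProb.
Context d (Omega : measurableType d) (R : realType) (Pr : probability Omega R).
Variables (J : finType) (M : nat).
Let K := nb_arms J M.
Variables (X : nat -> nat -> Omega -> R) (mu : nat -> R).
Variable Past : nat -> set (set Omega).

Definition adapted t d' (T : measurableType d') (f : Omega -> T) :=
  measurable_fun setT (f : g_sigma_algebraType (Past t) -> T).

Hypothesis K0 : (0 < K)%N.
Hypothesis PastM : forall t, <<s Past t >> `<=` measurable.
Hypothesis PastS : forall t, <<s Past t >> `<=` <<s Past t.+1 >>.
Hypothesis XM : forall t a, (a < K)%N -> adapted t.+1 (X t a).
Hypothesis X01 : forall t a w, (a < K)%N -> 0 <= X t a w <= 1.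
Hypothesis Xmu : forall t a, (a < K)%N -> (\int[Pr]_w (X t a w)%:E = (mu a)%:E)%E.
Hypothesis Xind : forall t a, (a < K)%N ->
  indep_sys Pr <<s Past t >> [set X t a @^-1` B | B in measurable].

Lemma adaptedS t d' (T : measurableType d') (f : Omega -> T) :
  adapted t f -> adapted t.+1 f.
Proof. by move=> mf _ B mB; apply: PastS; exact: (mf measurableT B mB). Qed.

Lemma adapted_measurable t d' (T : measurableType d') (f : Omega -> T) :
  adapted t f -> measurable_fun setT f.
Proof. by move=> mf _ B mB; apply: PastM (mf measurableT B mB). Qed.

Lemma adapted_preimage t d' (T : measurableType d') (f : Omega -> T) B :
  adapted t f -> measurable B -> <<s Past t >> (f @^-1` B).
Proof. by move=> mf mB; rewrite -[_ @^-1` _]setTI; exact: mf. Qed.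

Lemma adapted_nat_comp t d' (T : measurableType d') (f : nat -> T) (g : Omega -> nat) :
  adapted t g -> adapted t (fun w => f (g w)).
Proof. by move=> mg; apply: (@measurableT_comp _ _ _ _ _ _ f). Qed.

Let arm t w := ucb_arm J M (fun u a => X u a w) t.
Let cnt t a w := ucb_count J M (fun u a => X u a w) t a.
Let tot t a w := ucb_sum J M (fun u a => X u a w) t a.

(** The running maximum [v] is carried along with its position [b]: the comparison involves
    [f w (b w)], evaluated at a random index, and its measurability is part of the induction. *)
Lemma foldl_argmax_adapted t (f : Omega -> nat -> R) s :
  (forall k, k \in s -> adapted t (f^~ k)) ->
  forall (b : Omega -> nat) v, adapted t b -> adapted t v ->
  (forall w, v w = f w (b w)) ->
  adapted t (fun w => foldl (argmax_step (f w)) (b w) s).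
Proof.
elim: s => [|k s IH] fs b v mb mv vE //=.
have fk : adapted t (f^~ k) by apply: fs; exact: mem_head.
apply: (IH _ _ (fun w => if v w < f w k then f w k else v w)).
- by move=> j js; apply: fs; rewrite inE js orbT.
- rewrite /argmax_step; under eq_fun do rewrite -vE.
  by apply: measurable_fun_ifT => //; exact: measurable_fun_ltr.
- by apply: measurable_fun_ifT => //; exact: measurable_fun_ltr.
- by move=> w; rewrite /argmax_step -vE; case: ifP.
Qed.

Lemma arm_adapted_of t : (forall a, adapted t (cnt t a)) ->
  (forall a, (a < K)%N -> adapted t (tot t a)) -> adapted t (arm t).
Proof.
move=> mN mS; rewrite /arm; under eq_fun do rewrite ucb_armE.
case: ltnP => Kt; first exact: measurable_cst.
have mI k : (k < K)%N ->
    adapted t (fun w => ucb_index (ucb_hist J M (fun u a => X u a w) t) k).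
  move=> kK; rewrite /ucb_index.
  under eq_fun do rewrite size_ucb_hist.
  apply: measurable_funD.
    apply: measurable_funM; first exact: mS.
    exact: (@adapted_nat_comp t _ R (fun n => n%:R^-1) _ (mN k)).
  exact: (@adapted_nat_comp t _ R
    (fun n => Num.sqrt (2 * ln t%:R / n%:R)) _ (mN k)).
apply: (@foldl_argmax_adapted t
  (fun w => ucb_index (ucb_hist J M (fun u a => X u a w) t)) _ _ (fun _ => 0%N)
  (fun w => ucb_index (ucb_hist J M (fun u a => X u a w) t) 0%N)) => //.
- by move=> k; rewrite mem_iota add0n => /andP[_ kK]; exact: mI.
- exact: measurable_cst.
- exact: mI.
Qed.

Lemma arm_eq_adapted t a : adapted t (arm t) -> adapted t (fun w => arm t w == a).
Proof.
by move=> mA; exact: (@adapted_nat_comp t _ bool (fun n => n == a) _ mA).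
Qed.

Lemma cnt_tot_adapted t : (forall a, adapted t (cnt t a)) /\
  (forall a, (a < K)%N -> adapted t (tot t a)).
Proof.
elim: t => [|t [mN mS]].
  split=> a; first exact: measurable_cst.
  move=> _; rewrite /tot /ucb_sum /=.
  under eq_fun do rewrite big_nil.
  exact: measurable_cst.
have mA a : adapted t.+1 (fun w => arm t w == a).
  by apply: adaptedS; apply: arm_eq_adapted; exact: arm_adapted_of mN mS.
split=> a.
  rewrite /cnt; under eq_fun do rewrite ucb_countS.
  have -> : (fun w => (cnt t a w + (arm t w == a))%N) =
      (fun w => if arm t w == a then (cnt t a w).+1 else cnt t a w).
    by apply/funext => w; case: eqP => _; rewrite ?addn1 ?addn0.
  have mN' : adapted t.+1 (cnt t a) := adaptedS (mN a).
  have mN1 : adapted t.+1 (fun w => (cnt t a w).+1).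
    exact: (@adapted_nat_comp t.+1 _ nat S).
  exact (measurable_fun_ifT (mA a) mN1 mN').
move=> aK; rewrite /tot; under eq_fun do rewrite ucb_sumS.
apply: measurable_funD; first exact: (adaptedS (mS _ aK)).
by apply: measurable_fun_ifT; [exact (mA a)|exact (@XM t a aK)|exact: measurable_cst].
Qed.

Lemma arm_adapted t : adapted t (arm t).
Proof. by apply: arm_adapted_of; have [] := cnt_tot_adapted t. Qed.

(** Supermartingale property without conditional expectations: on the event that [a] is chosen, the
    product so far is a function of the past and the new factor is independent of it with mean at
    most 1; off this event the product does not change. *)
Lemma prod_chosen_expectation_le1 (g : R -> R) a t : (a < K)%N ->
  measurable_fun setT g -> (forall x, 0 <= g x) ->
  (forall u, (\int[Pr]_w (g (X u a w))%:E <= 1)%E) ->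
  (\int[Pr]_w (\prod_(u < t) (if arm u w == a then g (X u a w) else 1))%:E <= 1)%E.
Proof.
move=> aK mg g0 g1.
pose W t w := \prod_(u < t) (if arm u w == a then g (X u a w) else 1).
have W0 u w : 0 <= W u w by apply: prodr_ge0 => i _; case: ifP.
have mgX u : adapted u.+1 (g \o X u a).
  by apply: (@measurableT_comp _ _ _ _ _ _ g) => //; exact (@XM u a aK).
have mW u : adapted u (W u).
  elim: u => [|u IH].
    by rewrite /W; under eq_fun do rewrite big_ord0; exact: measurable_cst.
  rewrite /W; under eq_fun do rewrite big_ord_recr /=.
  apply: measurable_funM; first exact: (adaptedS IH).
  apply: measurable_fun_ifT; [|exact: mgX|exact: measurable_cst].
  by apply: adaptedS; apply: arm_eq_adapted; exact: arm_adapted.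
rewrite -/(W t); elim: t => [|t IH].
  under eq_integral do rewrite /W big_ord0.
  by rewrite integral_cst //= probability_setT mule1.
apply: le_trans IH.
pose W1 w := if arm t w == a then W t w else 0.
pose W2 w := if arm t w == a then 0 else W t w.
have mW1 : adapted t W1.
  apply: measurable_fun_ifT; [|exact: mW|exact: measurable_cst].
  by apply: arm_eq_adapted; exact: arm_adapted.
have mW2 : adapted t W2.
  apply: measurable_fun_ifT; [|exact: measurable_cst|exact: mW].
  by apply: arm_eq_adapted; exact: arm_adapted.
have W10 w : 0 <= W1 w by rewrite /W1; case: ifP.
have W20 w : 0 <= W2 w by rewrite /W2; case: ifP.
have -> : (\int[Pr]_w (W t.+1 w)%:E =
    \int[Pr]_w ((W1 w * g (X t a w))%:E + (W2 w)%:E))%E.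
  apply: eq_integral => w _; rewrite /W big_ord_recr /= -/(W t w) /W1 /W2.
  by case: ifP => _; rewrite ?mul0r ?mulr1 ?add0e ?adde0.
have -> : (\int[Pr]_w (W t w)%:E = \int[Pr]_w ((W1 w)%:E + (W2 w)%:E))%E.
  by apply: eq_integral => w _; rewrite /W1 /W2; case: ifP => _; rewrite ?add0e ?adde0.
have mW1' := adapted_measurable mW1; have mW2' := adapted_measurable mW2.
have mgX' := adapted_measurable (mgX t).
rewrite ge0_integralD //; last 4 first.
- by move=> w _; rewrite lee_fin mulr_ge0.
- by apply/measurable_EFinP; apply: measurable_funM.
- by move=> w _; rewrite lee_fin.
- exact/measurable_EFinP.
rewrite ge0_integralD //; last 4 first.
- by move=> w _; rewrite lee_fin.
- exact/measurable_EFinP.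
- by move=> w _; rewrite lee_fin.
- exact/measurable_EFinP.
apply: leeD => //.
rewrite (indep_expectation (@Xind t a aK)) //; last 2 first.
- by move=> B mB; exact: adapted_preimage.
- move=> B mB; exists (g @^-1` B) => //.
  by rewrite -[_ @^-1` _]setTI; exact: mg.
rewrite -[leRHS]mule1; apply: lee_wpmul2l => //.
by apply: integral_ge0 => w _; rewrite lee_fin.
Qed.

(* [s] is the sign of the deviation, [l] the Chernoff parameter. *)
Lemma chosen_mgf_le1 (s : bool) a t l : (a < K)%N -> 0 <= l ->
  (\int[Pr]_w (expR (l * ((-1) ^+ s * (tot t a w - mu a * (cnt t a w)%:R))
     - l ^+ 2 / 8 * (cnt t a w)%:R))%:E <= 1)%E.
Proof.
move=> aK l0.
pose g x := expR (l * ((-1) ^+ s * (x - mu a)) - l ^+ 2 / 8).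
have mg : measurable_fun setT g.
  apply: measurableT_comp => //; apply: measurable_funB => //.
  apply: measurable_funM => //; apply: measurable_funM => //.
  exact: measurable_funB.
rewrite (_ : (fun _ => _) =
    (fun w => (\prod_(u < t) (if arm u w == a then g (X u a w) else 1))%:E)); last first.
  apply/funext => w; congr EFin.
  elim: t => [|t IH].
    by rewrite big_ord0 /tot /cnt /ucb_sum /ucb_count /= big_nil !(mulr0, subr0) expR0.
  rewrite big_ord_recr -IH /= /tot /cnt ucb_sumS ucb_countS -/(arm t w).
  case: eqP => _; last by rewrite addr0 addn0 mulr1.
  by rewrite -expRD; congr expR; rewrite natrD /= mulr1n; ring.
apply: prod_chosen_expectation_le1 => // [x|u]; first exact: expR_ge0.
have mX : measurable_fun setT (X u a) := (adapted_measurable (@XM u a aK)).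
(* Hoeffding's lemma is available for [l >= 0] only, so downward deviations of [X] are treated as
   upward deviations of [1 - X]. *)
pose Y w := if s then 1 - X u a w else X u a w.
pose m := if s then 1 - mu a else mu a.
have mY : measurable_fun setT Y by rewrite /Y; case: (s) => //; exact: measurable_funB.
have Y01 w : 0 <= Y w <= 1.
  by have := @X01 u a w aK; rewrite /Y; case: (s) => //; lra.
have Ym : (\int[Pr]_w (Y w)%:E = m%:E)%E.
  rewrite /Y /m; case: (s); last exact: Xmu.
  under eq_integral do rewrite EFinB.
  rewrite integralB_EFin //.
  - by rewrite Xmu // integral_cst //= probability_setT mule1.
  - exact: finite_measure_integrable_cst.
  - apply: measurable_bounded_integrable => //=.
      by rewrite probability_setT ltry.
    exists 1; split => // x x1 w _ /=; apply: le_trans (ltW x1).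
    by have /andP[h1 h2] := @X01 u a w aK; rewrite ger0_norm.
have := hoeffding_mgf mY Y01 Ym l0.
set e := expR _ => Ee.
have -> : (\int[Pr]_w (g (X u a w))%:E = \int[Pr]_w ((e^-1)%:E * (expR (l * (Y w - m)))%:E))%E.
  apply: eq_integral => w _; rewrite -EFinM; congr EFin.
  rewrite /e -expRN -expRD /g; congr expR.
  by rewrite /Y /m; case: (s); ring.
have eV0 : 0 <= e^-1 by rewrite invr_ge0 expR_ge0.
rewrite ge0_integralZl_EFin //; last first.
  apply/measurable_EFinP; apply: measurableT_comp => //; apply: measurable_funM => //.
  exact: measurable_funB.
apply: (@le_trans _ _ ((e^-1)%:E * e%:E)%E).
  exact: lee_wpmul2l.
by rewrite -EFinM mulVf // gt_eqF // expR_gt0.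
Qed.

(* Weighted by [t ^ -4], the exponential whose Chernoff parameter is tuned to
   the actual number of plays is at least 1 on the bad event; hence the sum over
   all arms, all possible numbers of plays and both signs. *)
Definition ucb_bad_weight t w : R := \sum_(p : 'I_K * 'I_t * bool)
  t%:R ^- 4 *
  (let l := 4 * Num.sqrt (2 * ln t%:R / p.1.2.+1%:R) in
   expR (l * ((-1) ^+ p.2 * (tot t p.1.1 w - mu p.1.1 * (cnt t p.1.1 w)%:R))
     - l ^+ 2 / 8 * (cnt t p.1.1 w)%:R)).

Lemma ucb_bad_weight_ge0 t w : 0 <= ucb_bad_weight t w.
Proof.
by apply: sumr_ge0 => p _; rewrite mulr_ge0 ?expR_ge0 // invr_ge0 exprn_ge0.
Qed.

(** With [n] plays, [l = 4 * sqrt (2 ln t / n)] maximizes [l * D - l ^ 2 * n / 8] at the threshold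
    [D = sqrt (2 n ln t)]. The maximum is [4 * ln t], whose exponential cancels the weight
    [t ^ -4]. *)
Lemma ucb_bad_le_weight t w : (K <= t)%N ->
  (ucb_bad J M (fun u a => X u a w) mu t)%:R <= ucb_bad_weight t w.
Proof.
move=> Kt; case: (boolP (ucb_bad _ _ _ _ _)) => [|_]; last exact: ucb_bad_weight_ge0.
have t0 : (0 < t)%N by exact: leq_trans Kt.
have tr : 0 < t%:R :> R by rewrite ltr0n.
have lt0 : 0 <= ln t%:R :> R by rewrite ln_ge0 // ler1n.
move=> /existsP[a]; rewrite -/(cnt t a w) -/(tot t a w) => dev.
have n0 : (0 < cnt t a w)%N by apply: ucb_count_gt0.
have nt : ((cnt t a w).-1 < t)%N by rewrite prednK // ucb_count_le.
set D := tot t a w - _ in dev.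
(* The single summand that already reaches 1. Counts run from 1 to [t], so the ordinal stores the
   count minus one. *)
pose p : 'I_K * 'I_t * bool := (a, Ordinal nt, D < 0).
rewrite /ucb_bad_weight (bigD1 p) //=; rewrite prednK // -/D.
set n := cnt t a w in n0 dev *.
have nr : 0 < n%:R :> R by rewrite ltr0n.
set l := 4 * _; set rest := \sum_(_ | _) _.
have rest0 : 0 <= rest.
  by apply: sumr_ge0 => q _; rewrite mulr_ge0 ?expR_ge0 // invr_ge0 exprn_ge0.
have -> : (-1) ^+ (D < 0)%R * D = `|D|.
  by case: ltP => D0 /=; [rewrite expr1 mulN1r ltr0_norm|rewrite expr0 mul1r ger0_norm].
have q0 : 0 <= 2 * ln t%:R / n%:R :> R by rewrite divr_ge0 ?mulr_ge0 // ltW.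
have l0 : 0 <= l by rewrite mulr_ge0 // sqrtr_ge0.
have l2 : l ^+ 2 / 8 * n%:R = 4 * ln t%:R.
  by rewrite exprMn sqr_sqrtr //; field; rewrite lt0r_neq0.
have ls : l * Num.sqrt (2 * ln t%:R * n%:R) = 8 * ln t%:R.
  rewrite /l -mulrA -sqrtrM //.
  have -> : 2 * ln t%:R / n%:R * (2 * ln t%:R * n%:R) = (2 * ln t%:R) ^+ 2 :> R.
    by field; rewrite lt0r_neq0.
  by rewrite sqrtr_sqr ger0_norm ?mulr_ge0 //; ring.
apply: (@le_trans _ _ (t%:R ^- 4 * t%:R ^+ 4)).
  by rewrite mulVf // expf_neq0 // lt0r_neq0.
apply: (@le_trans _ _ (t%:R ^- 4 * expR (l * `|D| - l ^+ 2 / 8 * n%:R))); last first.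
  by rewrite lerDl.
rewrite ler_wpM2l ?invr_ge0 ?exprn_ge0 //.
have -> : t%:R ^+ 4 = expR (4 * ln t%:R) :> R.
  by rewrite expRM_natl lnK ?posrE.
rewrite ler_expR l2.
have := ler_wpM2l l0 (ltW dev); rewrite ls; lra.
Qed.

Lemma measurable_chosen_mgf (c l b : R) t a : (a < K)%N ->
  measurable_fun setT (fun w => c * expR (l * (b *
    (tot t a w - mu a * (cnt t a w)%:R)) - l ^+ 2 / 8 * (cnt t a w)%:R)).
Proof.
move=> aK; have [mN mS] := cnt_tot_adapted t.
have mn : measurable_fun setT (fun w => (cnt t a w)%:R : R).
  exact: (adapted_measurable (@adapted_nat_comp t _ R (fun n => n%:R) _ (mN a))).
have ms := adapted_measurable (mS a aK).
apply: measurable_funM => //; apply: measurableT_comp => //.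
apply: measurable_funB; last exact: measurable_funM.
apply: measurable_funM => //; apply: measurable_funM => //.
by apply: measurable_funB => //; exact: measurable_funM.
Qed.

Lemma measurable_ucb_bad_weight t : measurable_fun setT (ucb_bad_weight t).
Proof. by apply: measurable_sum => p; exact: measurable_chosen_mgf. Qed.

Lemma ucb_bad_weight_expectation t : (K <= t)%N ->
  (\int[Pr]_w (ucb_bad_weight t w)%:E <= (2 * t%:R ^- 2)%:E)%E.
Proof.
move=> Kt; have t0 : (0 < t)%N by exact: leq_trans Kt.
have tr : 0 < t%:R :> R by rewrite ltr0n.
have v0 : 0 <= t%:R ^- 4 :> R by rewrite invr_ge0 exprn_ge0.
under eq_integral do rewrite /ucb_bad_weight -sumEFin.
rewrite ge0_integral_sum //; last first.
  by move=> p; apply/measurable_EFinP; exact: measurable_chosen_mgf.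
apply: (@le_trans _ _ (\sum_(p : 'I_K * 'I_t * bool) (t%:R ^- 4)%:E)%E).
  apply: lee_sum => p _.
  under eq_integral do rewrite EFinM.
  rewrite ge0_integralZl_EFin //; last first.
    apply/measurable_EFinP; have := @measurable_chosen_mgf 1
      (4 * Num.sqrt (2 * ln t%:R / p.1.2.+1%:R)) ((-1) ^+ p.2) t p.1.1 (ltn_ord _).
    by under eq_fun do rewrite mul1r.
  rewrite -[leRHS]mule1; apply: lee_wpmul2l => //.
  by apply: chosen_mgf_le1 => //; rewrite mulr_ge0 // sqrtr_ge0.
rewrite sumEFin lee_fin sumr_const !card_prod !card_ord card_bool -[_ *+ (_ * _ * _)%N]mulr_natl.
rewrite (natrM _ (K * t)) (natrM _ K).
have KT : K%:R <= t%:R :> R by rewrite ler_nat.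
have -> : 2 * t%:R ^- 2 = t%:R * t%:R * 2 * t%:R ^- 4 :> R.
  by field; rewrite lt0r_neq0.
by do 3!apply: ler_wpM2r => //.
Qed.

Lemma sum_rsqr_le n m : (0 < n)%N -> \sum_(n <= t < m) t%:R ^- 2 <= 2 :> R.
Proof.
move=> n0; have [mn|/ltnW nm] := leqP m n; first by rewrite big_geq.
have nr : 1 <= n%:R :> R by rewrite ler1n.
(* Telescoping: [t ^ -2 <= 2 / (t * (t + 1))] for [t >= 1]. *)
suff : \sum_(n <= t < m) t%:R ^- 2 <= 2 * (n%:R^-1 - m%:R^-1) :> R.
  have : 0 <= m%:R^-1 :> R by rewrite invr_ge0.
  have : n%:R^-1 <= 1 :> R by rewrite invf_le1 // (lt_le_trans ltr01).
  lra.
elim: m nm => [|m IH]; first by rewrite leqn0 => /eqP n00; rewrite n00 in n0.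
rewrite leq_eqVlt => /orP[/eqP <-|]; first by rewrite big_geq // subrr mulr0.
rewrite ltnS => nm; rewrite big_nat_recr //=.
apply: le_trans (lerD (IH nm) (lexx _)) _.
have mr : 1 <= m%:R :> R by rewrite ler1n (leq_trans n0).
set q := n%:R^-1; rewrite -[m.+1%:R]natr1; set x : R := m%:R in mr *.
have x0 : 0 < x by lra.
have xn : x != 0 by rewrite lt0r_neq0.
have x1n : x + 1 != 0 by rewrite lt0r_neq0 // addr_gt0.
suff : x ^- 2 <= 2 * (x^-1 - (x + 1)^-1).
  by set a := x ^- 2; set b := x^-1; set c := (x + 1)^-1; lra.
have -> : 2 * (x^-1 - (x + 1)^-1) = x ^- 2 * (2 * x / (x + 1)).
  by field; rewrite ?xn ?x1n.
rewrite -[leLHS]mulr1; apply: ler_wpM2l; first by rewrite invr_ge0 exprn_ge0 // ltW.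
by rewrite ler_pdivlMr ?mul1r; lra.
Qed.

Lemma bounded_integrable (f : Omega -> R) (c : R) : measurable_fun setT f ->
  (forall w, `|f w| <= c) -> Pr.-integrable setT (EFin \o f).
Proof.
move=> mf fc; apply: measurable_bounded_integrable => //=.
  by rewrite probability_setT ltry.
by exists c; split; [exact: num_real|]=> x cx w _ /=; apply: le_trans (fc w) (ltW cx).
Qed.

(** The pathwise bound is integrated with the indicator of the bad event replaced by its majorant
    [ucb_bad_weight], whose measurability is already known. The final 4 is twice the bound 2 on the
    sum of the [t ^ -2]. *)
Lemma ucb_expected_regret k m T : (m <= T)%N -> (0 < T)%N -> (k < K)%N ->
  (forall a, (a < K)%N -> 0 <= mu a <= 1) ->
  (\int[Pr]_w (\sum_(0 <= t < m) (mu k - mu (arm t w)))%:E <=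
   (K%:R + 6 * Num.sqrt (2 * ln T%:R) * Num.sqrt (K%:R * m%:R) + 4)%:E)%E.
Proof.
move=> mT T0 kK mu01.
set c := K%:R + _.
have c0 : 0 <= c by rewrite addr_ge0 // !mulr_ge0 // sqrtr_ge0.
have mB t : measurable_fun setT (EFin \o ucb_bad_weight t).
  exact/measurable_EFinP/measurable_ucb_bad_weight.
pose B w := (\sum_(K <= t < m) (ucb_bad_weight t w)%:E)%E.
have B0 w : (0 <= B w)%E.
  by apply: sume_ge0 => t _; rewrite lee_fin ucb_bad_weight_ge0.
have EB : (\int[Pr]_w (c%:E + B w) <= (c + 4)%:E)%E.
  rewrite ge0_integralD //; last first.
    exact: emeasurable_sum.
  rewrite integral_cst //= probability_setT mule1 (EFinD c 4); apply: leeD2l.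
  rewrite /B ge0_integral_sum //; last first.
    by move=> t w _; rewrite lee_fin ucb_bad_weight_ge0.
  apply: (@le_trans _ _ (\sum_(K <= t < m) (2 * t%:R ^- 2)%:E)%E).
    rewrite big_nat [leRHS]big_nat.
    by apply: lee_sum => t /andP[Kt _]; exact: ucb_bad_weight_expectation.
  rewrite sumEFin lee_fin -mulr_sumr.
  have := @sum_rsqr_le K m K0; lra.
apply: (le_trans _ EB); apply: le_integral => //.
- apply: (@bounded_integrable _ m%:R).
    apply: measurable_sum => t; apply: measurable_funB => //.
    have mm : adapted t (fun w => mu (arm t w)) := adapted_nat_comp mu (@arm_adapted t).
    exact (adapted_measurable mm).
  move=> w; apply: le_trans (ler_norm_sum _ _ _) _.
  apply: (@le_trans _ _ (\sum_(0 <= t < m) 1)).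
    apply: ler_sum => t _; rewrite ler_norml.
    have := mu01 _ kK; have := mu01 _ (ucb_arm_lt (fun u a => X u a w) K0 t).
    by rewrite -/(arm t w); lra.
  by rewrite big_const_nat subn0 iter_addr addr0.
- apply/integrableP; split.
    by apply: emeasurable_funD => //; exact: emeasurable_sum.
  under eq_integral => w _ do rewrite gee0_abs ?adde_ge0 ?lee_fin //.
  by apply: (le_lt_trans EB); exact: ltry.
- move=> w _; rewrite /B sumEFin -EFinD lee_fin.
  apply: le_trans (ucb_path_regret (fun u a => X u a w) K0 mT T0 kK mu01) _.
  rewrite lerD2l big_nat [leRHS]big_nat; apply: ler_sum => t /andP[Kt _].
  exact: ucb_bad_le_weight.
Qed.
End UCBProb.

(** * Past and present blocks *)

Section Cylinders.
Context d (Omega : measurableType d) (R : realType) (Pr : probability Omega R).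
Variables (I : eqType) (F : I -> set (set Omega)).
Hypothesis FT : forall i, F i setT.
Hypothesis FI : forall i, setI_closed (F i).
Hypothesis FM : forall i, F i `<=` measurable.
Hypothesis Find : mutually_independent Pr F.

(** A pi-system generating the joint sigma-algebra of the blocks listed in [l]. The family [E] is
    total because every block contains the full set. *)
Definition cylinders (l : seq I) : set (set Omega) :=
  [set A | exists2 E, (forall i, F i (E i)) & A = \big[setI/setT]_(i <- l) E i].

Lemma cylinders_setI l : setI_closed (cylinders l).
Proof.
move=> _ _ [E FE ->] [E' FE' ->]; exists (fun i => E i `&` E' i).
  by move=> i; exact: FI.
by rewrite big_split.
Qed.

Lemma cylinders_measurable l : cylinders l `<=` measurable.
Proof.
move=> _ [E FE ->]; apply: big_ind => //; first exact: measurableI.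
by move=> i _; exact: FM.
Qed.

Lemma sigma_cylinders_measurable l : <<s cylinders l >> `<=` measurable.
Proof. exact: (smallest_sub (sigma_algebra_measurable _) (@cylinders_measurable l)). Qed.

Lemma sub_cylinders l i : uniq l -> i \in l -> F i `<=` cylinders l.
Proof.
move=> ul il A FA; exists (fun j => if j == i then A else setT).
  by move=> j; case: eqP => [->|].
rewrite (bigD1_seq i) //= eqxx big1 ?setIT // => j /negbTE -> //.
Qed.

Lemma sigma_cylinders_sub l l' : uniq l' -> {subset l <= l'} ->
  <<s cylinders l >> `<=` <<s cylinders l' >>.
Proof.
move=> ul' ll'; apply: smallest_sub; first exact: smallest_sigma_algebra.
move=> _ [E FE ->].
have : (measurable : set (set (g_sigma_algebraType (cylinders l'))))
    (\big[setI/setT]_(i <- l) E i); last by [].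
rewrite big_seq; apply: big_ind.
- exact: (@measurableT _ (g_sigma_algebraType (cylinders l'))).
- exact: (@measurableI _ (g_sigma_algebraType (cylinders l'))).
- move=> i il; apply: sub_sigma_algebra; apply: (sub_cylinders ul' (ll' _ il)).
  exact: FE.
Qed.

(** Mutual independence is applied to [l], to [l'] and to their concatenation; as the lists are
    disjoint, one family [E''] serves all three. *)
Lemma indep_cylinders l l' : uniq (l ++ l') ->
  indep_sys Pr (cylinders l) (cylinders l').
Proof.
move=> ull A B [E FE AE] [E' FE' BE].
have mA : measurable A by apply: (@cylinders_measurable l); exists E.
have mB : measurable B by apply: (@cylinders_measurable l'); exists E'.
pose E'' i := if i \in l then E i else E' i.
have FE'' i : F i (E'' i) by rewrite /E''; case: ifP.
have : (uniq l /\ uniq l') /\ forall i, i \in l' -> (i \in l) = false.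
  move: ull; rewrite cat_uniq => /and3P[ul nll' ul']; do !split => //.
  by move=> i il'; apply/negbTE/negP => il; case/hasP: nll'; exists i.
move=> [[ul ul'] nl].
have El : \big[setI/setT]_(i <- l) E'' i = A.
  by rewrite AE big_seq [RHS]big_seq; apply: eq_bigr => i il; rewrite /E'' il.
have El' : \big[setI/setT]_(i <- l') E'' i = B.
  by rewrite BE big_seq [RHS]big_seq; apply: eq_bigr => i il; rewrite /E'' nl.
have := Find ull (fun i _ => FE'' i).
rewrite !big_cat /= -(Find ul (fun i _ => FE'' i)) -(Find ul' (fun i _ => FE'' i)).
rewrite El El' /prob => PAB.
have fin C : measurable C -> Pr C \is a fin_num by move=> mC; rewrite fin_num_measure.
rewrite -(fineK (fin _ mA)) -(fineK (fin _ mB)) -EFinM -PAB fineK //.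
by apply: fin; exact: measurableI.
Qed.

Lemma indep_sigma_cylinders l l' : uniq (l ++ l') ->
  indep_sys Pr <<s cylinders l >> <<s cylinders l' >>.
Proof.
move=> ull; apply: indep_sys_sigmal.
- exact: cylinders_measurable.
- exact: sigma_cylinders_measurable.
- exact: cylinders_setI.
apply: indep_sysC; apply: indep_sys_sigmal.
- exact: cylinders_measurable.
- exact: cylinders_measurable.
- exact: cylinders_setI.
by apply: indep_sysC; exact: indep_cylinders.
Qed.

End Cylinders.

(** * Encoding of the grid arms *)

Section Grid.
Variables (R : realType) (J : finType) (M : nat).

Lemma grid_arm_valid k : (k < nb_arms J M)%N ->
  exists j s, grid_arm R J M k = Some (j, s) /\ unit_box s.
Proof.
rewrite /nb_arms -mulnA => kK.
have M0 : (0 < M)%N by case: M kK => [|//]; rewrite ?muln0 ltn0.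
have MM0 : (0 < M * M)%N by rewrite muln_gt0 M0.
have kJ : (k %/ (M * M) < #|J|)%N by rewrite ltn_divLR.
have [j0 _] : exists j0 : J, j0 \in J by apply/card_gt0P/(leq_trans _ kJ).
have ubr c : (c < M)%N -> 0 <= (c.+1%:R / M%:R : R) <= 1.
  move=> cM; rewrite divr_ge0 //= ler_pdivrMr ?ltr0n // mul1r ler_nat //.
rewrite /grid_arm (nth_map j0) -?cardE //=.
eexists; eexists; split; first by [].
split; apply: ubr; last by rewrite ltn_pmod.
by rewrite ltn_divLR // ltn_pmod.
Qed.

Lemma grid_arm_surj j a b : (a < M)%N -> (b < M)%N ->
  exists2 k, (k < nb_arms J M)%N &
    grid_arm R J M k = Some (j, (a.+1%:R / M%:R, b.+1%:R / M%:R)).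
Proof.
move=> aM bM; have M0 : (0 < M)%N by exact: leq_trans aM.
have abMM : (a * M + b < M * M)%N.
  by apply: (@leq_trans (a * M + M)); [rewrite ltn_add2l|rewrite addnC -mulSn leq_mul2r aM orbT].
exists (index j (enum J) * (M * M) + (a * M + b))%N.
  rewrite /nb_arms -mulnA.
  apply: (@leq_trans ((index j (enum J)).+1 * (M * M))).
    by rewrite mulSn addnC ltn_add2r.
  by rewrite leq_mul2r cardE index_mem mem_enum orbT.
rewrite /grid_arm divnMDl ?muln_gt0 ?M0 // (divn_small abMM) addn0.
rewrite (nth_map j) ?index_mem ?mem_enum // nth_index ?mem_enum //=.
rewrite modnMDl (modn_small abMM) divnMDl // (divn_small bM) addn0.
by rewrite mulnA addnA -mulnDl modnMDl (modn_small bM).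
Qed.
End Grid.

(** * The stochastic bandit faced by the jammer *)

Section JBProb.
Context d (Omega : measurableType d) (R : realType) (Pr : probability Omega R).
Variables (J P : finType) (V : nat -> Omega -> P).
Variables (C : nat -> P -> J -> R * R -> Omega -> R) (Cbar : P -> J -> R * R -> R).
Variable p : P -> R.
Hypothesis p0 : forall i, 0 <= p i.
Hypothesis p1 : \sum_(i : P) p i = 1.
Hypothesis VM : forall t, (0 < t)%N -> forall i, measurable (V t @^-1` [set i]).
Hypothesis Vp : forall t, (0 < t)%N -> forall i, prob Pr (V t @^-1` [set i]) = p i.
Hypothesis CM : forall t i j s, (0 < t)%N -> unit_box s ->
     measurable_fun setT (C t i j s) /\ forall w, 0 <= C t i j s w <= 1.
Hypothesis Cmean : forall t i j s, (0 < t)%N -> unit_box s ->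
     (\int[Pr]_w (C t i j s w)%:E = (Cbar i j s)%:E)%E.
Hypothesis VCind : mutually_independent Pr (time_blocks V C).

Let cyl := cylinders (time_blocks V C).

Lemma time_blocksT x : time_blocks V C x setT.
Proof.
case: x => u /=; first by exists setT => //; exact: preimage_setT.
exact: (@measurableT _ (g_sigma_algebraType _)).
Qed.

Lemma time_blocksI x : setI_closed (time_blocks V C x).
Proof.
case: x => u /=; last exact: (@measurableI _ (g_sigma_algebraType _)).
by move=> _ _ [B _ <-] [B' _ <-]; exists (B `&` B') => //; rewrite preimage_setI.
Qed.

Lemma time_blocks_measurable x : time_blocks V C x `<=` measurable.
Proof.
case: x => u /=.
  move=> _ [B _ <-].
  have -> : V u.+1 @^-1` B = \bigcup_(i in B) V u.+1 @^-1` [set i].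
    by apply/seteqP; split => [w Bw|w [i Bi /= Vi]]; [exists (V u.+1 w)|rewrite /= Vi].
  by apply: fin_bigcup_measurable => [|i _]; [exact: finite_finset|exact: VM].
apply: smallest_sub; first exact: sigma_algebra_measurable.
move=> _ [i [j [s [B [us mB ->]]]]].
by rewrite -[_ @^-1` _]setTI; exact: (CM i j _ us).1.
Qed.

(** Block index [u] stands for time [u.+1]: the past of time [t] consists of the times 1 to [t - 1],
    that is of the indices below [t.-1], and the present has index [t.-1]. *)
Definition past_idx t : seq (nat + nat) :=
  map inl (iota 0 t.-1) ++ map inr (iota 0 t.-1).
Definition now_idx t : seq (nat + nat) := [:: inl t.-1; inr t.-1].

Lemma uniq_past_now t : uniq (past_idx t ++ now_idx t).
Proof.
have inlI : injective (@inl nat nat) by move=> ? ? [].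
have inrI : injective (@inr nat nat) by move=> ? ? [].
rewrite cat_uniq /past_idx cat_uniq !map_inj_uniq // !iota_uniq /= !mem_cat.
rewrite !mem_map // mem_iota ltnn /= orbF !andbT.
apply/andP; split; last first.
  by rewrite orbF; apply/norP; split; apply/mapP => -[].
by apply/hasPn => x /mapP[y _ ->]; apply/mapP => -[].
Qed.

Lemma past_idxS t : (0 < t)%N -> {subset past_idx t ++ now_idx t <= past_idx t.+1}.
Proof.
case: t => // t _ x.
have E : iota 0 t.+2.-1 = rcons (iota 0 t.+1.-1) t.
  by rewrite -cats1 -[[:: t]]/(iota (0 + t) 1) -iotaD addn1.
rewrite /past_idx E !map_rcons !mem_cat !mem_rcons !inE.
by move=> /orP[/orP[->|->]|/orP[->|->]]; rewrite ?orbT.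
Qed.

Let past t := cyl (past_idx t).
Let now t := cyl (now_idx t).

Lemma past_measurable t : <<s past t >> `<=` measurable.
Proof. exact: sigma_cylinders_measurable time_blocks_measurable _. Qed.

Let uniq_past t : uniq (past_idx t).
Proof. by have := uniq_past_now t; rewrite cat_uniq => /andP[]. Qed.

Lemma pastS t : (0 < t)%N -> <<s past t >> `<=` <<s past t.+1 >>.
Proof.
move=> t0; apply: sigma_cylinders_sub => //; first exact: time_blocksT.
by move=> x xt; apply: past_idxS => //; rewrite mem_cat xt.
Qed.

Lemma now_past t : (0 < t)%N -> <<s now t >> `<=` <<s past t.+1 >>.
Proof.
move=> t0; apply: sigma_cylinders_sub => //; first exact: time_blocksT.
by move=> x xt; apply: past_idxS => //; rewrite mem_cat xt orbT.
Qed.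

Lemma past_now_indep t : indep_sys Pr <<s past t >> <<s now t >>.
Proof.
apply: indep_sigma_cylinders => //; [exact: time_blocksI|exact: time_blocks_measurable|].
exact: uniq_past_now.
Qed.

Lemma sigma_V_now t : (0 < t)%N -> sigma_V V t `<=` <<s now t >>.
Proof.
move=> t0 A VA; apply: sub_sigma_algebra.
apply: (@sub_cylinders _ _ _ _ time_blocksT (now_idx t) (inl t.-1)) => //.
- by rewrite inE eqxx.
- by rewrite /= prednK.
Qed.

Lemma sigma_C_now t : (0 < t)%N -> sigma_C C t `<=` <<s now t >>.
Proof.
move=> t0 A VA; apply: sub_sigma_algebra.
apply: (@sub_cylinders _ _ _ _ time_blocksT (now_idx t) (inr t.-1)) => //.
- by rewrite !inE eqxx orbT.
- by rewrite /= prednK.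
Qed.

Lemma sigma_V_C_indep t : (0 < t)%N -> indep_sys Pr (sigma_V V t) (sigma_C C t).
Proof.
move=> t0 A B VA CB.
have /= := @indep_cylinders _ _ _ Pr _ _ time_blocks_measurable VCind
  [:: inl t.-1] [:: inr t.-1] isT A B.
apply.
- by apply: (@sub_cylinders _ _ _ _ time_blocksT _ (inl t.-1)) => //; rewrite ?inE //= prednK.
- by apply: (@sub_cylinders _ _ _ _ time_blocksT _ (inr t.-1)) => //; rewrite ?inE //= prednK.
Qed.

Lemma C_preimage t i j s B : unit_box s -> measurable B ->
  sigma_C C t (C t i j s @^-1` B).
Proof. by move=> us mB; apply: sub_sigma_algebra; exists i, j, s, B. Qed.

Definition arm_mean (a : option (J * (R * R))) : R :=
  if a is Some (j, s) then \sum_(i : P) p i * Cbar i j s else 0.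

Lemma Cbar01 i j s : unit_box s -> 0 <= Cbar i j s <= 1.
Proof.
move=> us; have [mC C01] := @CM 1 i j s isT us.
rewrite -!lee_fin -(@Cmean 1 i j s) // integral_ge0 /=; last first.
  by move=> w _; rewrite lee_fin; case/andP: (C01 w).
have <- : (\int[Pr]_w 1%:E = 1%:E)%E by rewrite integral_cst //= probability_setT mule1.
apply: ge0_le_integral => //.
- by move=> w _; rewrite lee_fin; case/andP: (C01 w).
- exact/measurable_EFinP.
- by move=> w _; rewrite lee_fin; case/andP: (C01 w).
Qed.

Lemma arm_mean01 j s : unit_box s -> 0 <= arm_mean (Some (j, s)) <= 1.
Proof.
move=> us; rewrite /arm_mean; apply/andP; split.
  by apply: sumr_ge0 => i _; rewrite mulr_ge0 //; case/andP: (Cbar01 i j us).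
rewrite -p1; apply: ler_sum => i _; rewrite -[leRHS]mulr1 ler_wpM2l //.
by case/andP: (Cbar01 i j us).
Qed.

Lemma obs_reward_now t j s B : (0 < t)%N -> unit_box s -> measurable B ->
  <<s now t >> (obs_reward V C t (Some (j, s)) @^-1` B).
Proof.
move=> t0 us mB.
have -> : obs_reward V C t (Some (j, s)) @^-1` B =
    \bigcup_(i in setT) (V t @^-1` [set i] `&` C t i j s @^-1` B).
  apply/seteqP; split => [w Bw|w [i _ [/= Vi Bw]]]; first by exists (V t w).
  by rewrite /= Vi.
apply: (@fin_bigcup_measurable _ (g_sigma_algebraType (now t))) => [|i _].
  exact: finite_finset.
apply: (@measurableI _ (g_sigma_algebraType (now t))).
  by apply: sigma_V_now => //; exists [set i].
by apply: sigma_C_now => //; exact: C_preimage.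
Qed.

(** This is where the hidden strategy becomes noise: the observed reward is split according to the
    value of [V t], and independence of [V t] from the rewards of the same time turns each term into
    [p i * Cbar i j s]. *)
Lemma obs_reward_mean t j s : (0 < t)%N -> unit_box s ->
  (\int[Pr]_w (obs_reward V C t (Some (j, s)) w)%:E = (arm_mean (Some (j, s)))%:E)%E.
Proof.
move=> t0 us; rewrite /arm_mean -sumEFin.
have mV i : measurable_fun setT (fun w => (V t w == i)%:R : R).
  have -> : (fun w => (V t w == i)%:R) = \1_(V t @^-1` [set i]) :> (Omega -> R).
    by apply/funext => w; rewrite indicE; congr (nat_of_bool _)%:R;
      apply/eqP/idP; rewrite inE.
  by apply: measurable_indic; exact: VM.
have -> : (\int[Pr]_w (obs_reward V C t (Some (j, s)) w)%:E =
   \int[Pr]_w (\sum_(i : P) ((V t w == i)%:R * C t i j s w)%:E))%E.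
  apply: eq_integral => w _; rewrite sumEFin; congr EFin.
  rewrite (bigD1 (V t w)) //= eqxx mul1r big1 ?addr0 // => i /negbTE iV.
  by rewrite eq_sym iV mul0r.
rewrite ge0_integral_sum //; last 2 first.
- by move=> i; apply/measurable_EFinP; apply: measurable_funM => //; exact: (CM i j t0 us).1.
- move=> i w _; rewrite lee_fin mulr_ge0 //.
  by have [_ /(_ w)/andP[]] := CM i j t0 us.
apply: eq_bigr => i _.
have [mC C01] := CM i j t0 us.
rewrite (indep_expectation (sigma_V_C_indep t0)) //.
- rewrite Cmean // EFinM; congr (_ * _)%E.
  have -> : (\int[Pr]_w ((V t w == i)%:R)%:E = Pr (V t @^-1` [set i]))%E.
    rewrite -[X in Pr X]setIT -integral_indic //; last exact: VM.
    by apply: eq_integral => w _; congr EFin; rewrite indicE; congr (nat_of_bool _)%:R;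
      apply/eqP/idP; rewrite inE.
  by rewrite -(Vp t0) /prob fineK // fin_num_measure //; exact: VM.
- move=> B mB; exists [set i' | B (i' == i)%:R] => //.
- by move=> B mB; exact: C_preimage.
- by move=> w; case/andP: (C01 w).
Qed.

Definition valid_arm (o : option (J * (R * R))) : Prop :=
  if o is Some (_, s) then unit_box s else True.
Definition arm_reward t i (o : option (J * (R * R))) w : R :=
  if o is Some (j, s) then C t i j s w else 0.
Definition arm_reward_mean i (o : option (J * (R * R))) : R :=
  if o is Some (j, s) then Cbar i j s else 0.

Lemma arm_meanE o : arm_mean o = \sum_(i : P) p i * arm_reward_mean i o.
Proof. by case: o => [[j s]|] //=; rewrite big1 // => i _; rewrite mulr0. Qed.

Lemma measurable_arm_reward t i o : (0 < t)%N -> valid_arm o ->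
  measurable_fun setT (arm_reward t i o).
Proof.
by move=> t0; case: o => [[j s] us|_]; [exact: (CM i j t0 us).1|exact: measurable_cst].
Qed.

Lemma arm_reward01 t i o w : (0 < t)%N -> valid_arm o -> 0 <= arm_reward t i o w <= 1.
Proof.
by move=> t0; case: o => [[j s] us|_] /=; [exact: (CM i j t0 us).2|rewrite lexx ler01].
Qed.

(** Meant for [Z] the indicator that a given arm is chosen at time [t], a function of the past and
    thus independent of the rewards at [t]. *)
Lemma past_reward_expectation t i o (Z : Omega -> R) : (0 < t)%N -> valid_arm o ->
  adapted past t Z -> (forall w, 0 <= Z w) ->
  (\int[Pr]_w (Z w * arm_reward t i o w)%:E =
   \int[Pr]_w (Z w * arm_reward_mean i o)%:E)%E.
Proof.
move=> t0; case: o => [[j s] /= us|_ _ _ //] mZ Z0.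
have mZ' := adapted_measurable past_measurable mZ.
have [mC C01] := CM i j t0 us.
rewrite (indep_expectation (@past_now_indep t)) //.
- rewrite Cmean // muleC; under [RHS]eq_integral do rewrite mulrC EFinM.
  rewrite ge0_integralZl_EFin //; last by case/andP: (Cbar01 i j us).
    by move=> w _; rewrite lee_fin.
  exact/measurable_EFinP.
- by move=> B mB; exact: (adapted_preimage mZ).
- by move=> B mB; apply: sigma_C_now => //; exact: C_preimage.
- by move=> w; case/andP: (C01 w).
Qed.

(** * Expected regret of one step *)

Section Step.
Variables (M t : nat) (jstar : J) (sstar : R * R) (a : Omega -> nat).
Let K := nb_arms J M.
Hypothesis t0 : (0 < t)%N.
Hypothesis usstar : unit_box sstar.
Hypothesis aK : forall w, (a w < K)%N.
Hypothesis ma : adapted past t a.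
Let star := Some (jstar, sstar).
Let arm k := grid_arm R J M k.

Definition step_regret w := \sum_(i : P)
  p i * (C t i jstar sstar w - arm_reward t i (arm (a w)) w).

Lemma arm_valid k : (k < K)%N -> valid_arm (arm k).
Proof. by move=> kK; have [j [s [Ek us]]] := grid_arm_valid R kK; rewrite /arm Ek. Qed.

Let z k w : R := (a w == k)%:R.

Let sum_z (G : 'I_K -> P -> R) w :
  \sum_(q : 'I_K * P) p q.2 * (z q.1 w * G q.1 q.2) =
  \sum_(i : P) p i * G (Ordinal (aK w)) i.
Proof.
rewrite -(pair_bigA _ (fun (k : 'I_K) i => p i * (z k w * G k i))) /=.
rewrite (bigD1 (Ordinal (aK w))) //= [X in _ + X]big1 ?addr0.
  by apply: eq_bigr => i _; rewrite /z /= eqxx mul1r.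
move=> k; rewrite -val_eqE /= => /negbTE ka; rewrite big1 // => i _.
by rewrite /z eq_sym ka mul0r mulr0.
Qed.

(** Indicators of the finitely many choices replace the random arm by fixed ones, for which
    independence of the current reward from the past can be applied. *)
Lemma step_regretE w : step_regret w = \sum_(q : 'I_K * P)
  p q.2 * (z q.1 w * (arm_reward t q.2 star w - arm_reward t q.2 (arm q.1) w)).
Proof.
by rewrite (sum_z (fun k i => arm_reward t i star w - arm_reward t i (arm k) w)).
Qed.

Let mz k : adapted past t (z k).
Proof. exact: (@adapted_nat_comp _ _ past t _ R (fun n => (n == k)%:R) _ ma). Qed.

Lemma measurable_step_regret : measurable_fun setT step_regret.
Proof.
rewrite (_ : step_regret = fun w => \sum_(q : 'I_K * P)
  p q.2 * (z q.1 w * (arm_reward t q.2 star w - arm_reward t q.2 (arm q.1) w))).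
  apply: measurable_sum => q; apply: measurable_funM => //; apply: measurable_funM.
    exact: (adapted_measurable past_measurable (mz _)).
  by apply: measurable_funB; apply: measurable_arm_reward => //; exact: arm_valid.
by apply/funext => w; exact: step_regretE.
Qed.

Lemma step_regret_le1 w : `|step_regret w| <= 1.
Proof.
apply: le_trans (ler_norm_sum _ _ _) _; rewrite -p1; apply: ler_sum => i _.
rewrite normrM ger0_norm // -[leRHS]mulr1 ler_wpM2l // ler_norml.
have := arm_reward01 i w t0 (arm_valid (aK w)).
have := arm_reward01 i w t0 (usstar : valid_arm star).
by rewrite /=; lra.
Qed.

(** Compared term by term over pairs of an arm and a strategy. Differences of rewards may be
    negative, so each is first split into two nonnegative bounded integrands. *)
Lemma step_regret_expectation : (\int[Pr]_w (step_regret w)%:E =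
  \int[Pr]_w (arm_mean star - arm_mean (arm (a w)))%:E)%E.
Proof.
have z01 k w : 0 <= z k w <= 1 by rewrite /z; case: eqP => _ /=; lra.
have mz' k : measurable_fun setT (z k).
  exact: (adapted_measurable past_measurable (mz _)).
have vq (q : 'I_K * P) : valid_arm (arm q.1) by exact: arm_valid.
have b1 x y : 0 <= x <= 1 -> 0 <= y <= 1 -> `|x * y| <= 1 :> R.
  move=> /andP[x0 x1] /andP[y0 y1].
  by rewrite ger0_norm ?mulr_ge0 // -[leRHS]mulr1 ler_pM.
have iz k i o : valid_arm o ->
    Pr.-integrable setT (EFin \o (fun w => z k w * arm_reward t i o w)).
  move=> vo; apply: (@bounded_integrable _ _ _ _ _ 1).
    by apply: measurable_funM => //; exact: measurable_arm_reward.
  by move=> w; apply: b1 => //; exact: arm_reward01.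
have izm k i o : valid_arm o ->
    Pr.-integrable setT (EFin \o (fun w => z k w * arm_reward_mean i o)).
  move=> vo; apply: (@bounded_integrable _ _ _ _ _ 1).
    by apply: measurable_funM.
  move=> w; apply: b1 => //; case: o vo => [[j s] us|_] /=.
    exact: Cbar01.
  by rewrite lexx ler01.
under eq_integral do rewrite step_regretE -sumEFin.
under [RHS]eq_integral.
  move=> w _; rewrite !arm_meanE -sumrB.
  under eq_bigr do rewrite -mulrBr.
  rewrite -(sum_z (fun k i => arm_reward_mean i star - arm_reward_mean i (arm k))) -sumEFin.
  over.
have distr1 (q : 'I_K * P) w : (p q.2 * (z q.1 w *
      (arm_reward t q.2 star w - arm_reward t q.2 (arm q.1) w)))%:E =
    ((p q.2)%:E * ((z q.1 w * arm_reward t q.2 star w)%:E -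
       (z q.1 w * arm_reward t q.2 (arm q.1) w)%:E))%E.
  by rewrite mulrBr.
have distr2 (q : 'I_K * P) w : (p q.2 * (z q.1 w *
      (arm_reward_mean q.2 star - arm_reward_mean q.2 (arm q.1))))%:E =
    ((p q.2)%:E * ((z q.1 w * arm_reward_mean q.2 star)%:E -
       (z q.1 w * arm_reward_mean q.2 (arm q.1))%:E))%E.
  by rewrite mulrBr.
have i1 (q : 'I_K * P) : Pr.-integrable setT (fun w =>
    ((z q.1 w * arm_reward t q.2 star w)%:E -
       (z q.1 w * arm_reward t q.2 (arm q.1) w)%:E)%E).
  by apply: integrableB => //; apply: iz.
have i2 (q : 'I_K * P) : Pr.-integrable setT (fun w =>
    ((z q.1 w * arm_reward_mean q.2 star)%:E -
       (z q.1 w * arm_reward_mean q.2 (arm q.1))%:E)%E).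
  by apply: integrableB => //; apply: izm.
rewrite integral_sum //; last first.
  move=> q; under eq_fun do rewrite distr1.
  exact: integrableZl.
rewrite integral_sum //; last first.
  move=> q; under eq_fun do rewrite distr2.
  exact: integrableZl.
apply: eq_bigr => q _.
under eq_integral do rewrite distr1.
under [RHS]eq_integral do rewrite distr2.
rewrite integralZl // [RHS]integralZl //; congr (_ * _)%E.
rewrite integralB_EFin //; [|exact: iz..].
rewrite integralB_EFin //; [|exact: izm..].
have z0 k w : 0 <= z k w by case/andP: (z01 k w).
by congr (_ - _)%E; apply: past_reward_expectation.
Qed.

End Step.

(** * Expected regret of one epoch *)

Section Epoch.
Variables (M T : nat).
Hypothesis T0 : (0 < T)%N.
Hypothesis K0 : (0 < nb_arms J M)%N.
Let K := nb_arms J M.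

Let X u a w := obs_reward V C (T + u) (grid_arm R J M a) w.
Let mu a := arm_mean (grid_arm R J M a).
(** The past at step [u] of the epoch includes the times before [T]; UCB1 ignores them, but
    adaptedness and independence hold for this larger past as well. *)
Let Past u := past (T + u).

Let Tu0 u : (0 < T + u)%N. Proof. by rewrite ltn_addr. Qed.

Let PastM u : <<s Past u >> `<=` measurable.
Proof. exact: past_measurable. Qed.

Let PastS u : <<s Past u >> `<=` <<s Past u.+1 >>.
Proof. by rewrite /Past addnS; exact: pastS. Qed.

Let XE u a : (a < K)%N -> exists j s,
  [/\ X u a = obs_reward V C (T + u) (Some (j, s)),
      mu a = arm_mean (Some (j, s)) & unit_box s].
Proof.
move=> aK; have [j [s [Ea us]]] := grid_arm_valid R aK.
by exists j, s; split => //; [apply/funext => w|]; rewrite /X /mu Ea.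
Qed.

Let XM u a : (a < K)%N -> adapted Past u.+1 (X u a).
Proof.
move=> aK _ B mB; rewrite setTI; have [j [s [-> _ us]]] := XE u aK.
suff : <<s Past u.+1 >> (obs_reward V C (T + u) (Some (j, s)) @^-1` B) by [].
by rewrite /Past addnS; apply: now_past => //; exact: obs_reward_now.
Qed.

Let X01 u a w : (a < K)%N -> 0 <= X u a w <= 1.
Proof.
move=> aK; have [j [s [-> _ us]]] := XE u aK.
exact: (CM _ j (Tu0 u) us).2.
Qed.

Let Xmu u a : (a < K)%N -> (\int[Pr]_w (X u a w)%:E = (mu a)%:E)%E.
Proof.
move=> aK; have [j [s [-> -> us]]] := XE u aK.
exact: obs_reward_mean.
Qed.

Let Xind u a : (a < K)%N ->
  indep_sys Pr <<s Past u >> [set X u a @^-1` B | B in measurable].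
Proof.
move=> aK A _ FA [B mB <-]; apply: (@past_now_indep (T + u) A _ FA).
have [j [s [-> _ us]]] := XE u aK.
exact: obs_reward_now.
Qed.

Definition epoch_arm u w := ucb_arm J M (fun v a => X v a w) u.

Lemma epoch_arm_adapted u : adapted past (T + u) (epoch_arm u).
Proof. exact: (@arm_adapted _ _ _ J M X Past K0 PastS XM u). Qed.

Lemma epoch_arm_lt u w : (epoch_arm u w < K)%N.
Proof. exact: ucb_arm_lt. Qed.

Variables (jstar : J) (sstar : R * R).
Hypothesis usstar : unit_box sstar.
Let star := arm_mean (Some (jstar, sstar)).

Let mu01 a : (a < K)%N -> 0 <= mu a <= 1.
Proof. by move=> aK; have [j [s [_ -> us]]] := XE 0 aK; exact: arm_mean01. Qed.

Definition epoch_step_regret u :=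
  step_regret M (T + u) jstar sstar (epoch_arm u).

Let arm_lt u w := epoch_arm_lt u w.

Lemma integrable_epoch_step_regret u :
  Pr.-integrable setT (EFin \o epoch_step_regret u).
Proof.
apply: (@bounded_integrable _ _ _ _ _ 1).
  exact: (@measurable_step_regret M _ jstar sstar _ (Tu0 u) usstar (arm_lt u)
    (@epoch_arm_adapted u)).
by move=> w; apply: step_regret_le1.
Qed.

Definition epoch_mean_regret u := fine (\int[Pr]_w (epoch_step_regret u w)%:E).

Lemma epoch_mean_regretE u :
  (\int[Pr]_w (epoch_step_regret u w)%:E = (epoch_mean_regret u)%:E)%E.
Proof.
rewrite /epoch_mean_regret fineK //.
exact: (integrable_fin_num measurableT (integrable_epoch_step_regret u)).
Qed.

Lemma epoch_mean_regret_le1 u : epoch_mean_regret u <= 1.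
Proof.
rewrite -lee_fin -epoch_mean_regretE.
have <- : (\int[Pr]_w 1%:E = 1%:E)%E by rewrite integral_cst //= probability_setT mule1.
apply: le_integral => //.
- exact: integrable_epoch_step_regret.
- exact: finite_measure_integrable_cst.
- move=> w _; rewrite lee_fin; apply: le_trans (ler_norm _) _.
  exact: step_regret_le1.
Qed.

(** The optimum need not lie on the grid, so each step is compared with it through the grid arm [k]:
    [star - mu k] is the discretization error and the remainder is regret of UCB1 against [k]. *)
Lemma epoch_regret k m : (m <= T)%N -> (k < K)%N ->
  \sum_(0 <= u < m) epoch_mean_regret u <= m%:R * (star - mu k)
    + (K%:R + 6 * Num.sqrt (2 * ln T%:R) * Num.sqrt (K%:R * m%:R) + 4).
Proof.
move=> mT kK.
have mmu u : measurable_fun setT (fun w => mu (epoch_arm u w)).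
  have ad : adapted past (T + u) (fun w => mu (epoch_arm u w)) :=
    adapted_nat_comp mu (@epoch_arm_adapted u).
  exact (adapted_measurable past_measurable ad).
have star01 : 0 <= star <= 1 by exact: arm_mean01.
have int c u : 0 <= c <= 1 ->
    Pr.-integrable setT (EFin \o (fun w => c - mu (epoch_arm u w))).
  move=> c01; apply: (@bounded_integrable _ _ _ _ _ 1).
    exact: measurable_funB.
  by move=> w; have := mu01 (arm_lt u w); rewrite ler_norml; lra.
rewrite -lee_fin -sumEFin.
have -> : (\sum_(0 <= u < m) (epoch_mean_regret u)%:E =
    \sum_(0 <= u < m) \int[Pr]_w (star - mu (epoch_arm u w))%:E)%E.
  apply: eq_bigr => u _; rewrite -epoch_mean_regretE /epoch_step_regret.
  by rewrite (step_regret_expectation _ (Tu0 u) usstar (arm_lt u) (@epoch_arm_adapted u)).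
rewrite -integral_sum //; last by move=> u; exact: int.
have -> : (\int[Pr]_w (\sum_(0 <= u < m) (star - mu (epoch_arm u w))%:E) =
   \int[Pr]_w ((m%:R * (star - mu k))%:E +
     (\sum_(0 <= u < m) (mu k - mu (epoch_arm u w)))%:E))%E.
  apply: eq_integral => w _; rewrite sumEFin -EFinD; congr EFin.
  have -> : m%:R * (star - mu k) = \sum_(0 <= u < m) (star - mu k).
    by rewrite big_const_nat subn0 iter_addr addr0 mulr_natl.
  by rewrite -big_split /=; apply: eq_bigr => u _; ring.
rewrite integralD //=; last 2 first.
- exact: finite_measure_integrable_cst.
- rewrite (_ : (fun _ => _) = (fun w => \sum_(0 <= u < m) (mu k - mu (epoch_arm u w))%:E)%E).
    by apply: integrable_sum => // u _; apply: int; exact: mu01.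
  by apply/funext => w; rewrite sumEFin.
rewrite integral_cst //= probability_setT mule1 (EFinD (m%:R * _)); apply: leeD2l.
exact: (@ucb_expected_regret _ _ _ Pr J M X mu Past K0 PastM PastS XM X01 Xmu Xind).
Qed.
End Epoch.
End JBProb.

(** * Choice of the grid parameter *)

Section EpochBound.
Variable R : realType.

(** Follows from [ln (1 + x) <= x] at [x = - 1 / 2]; it keeps [ln T] away from 0 in all epochs with
    [T >= 2]. *)
Lemma ln2_ge_half : 1 / 2 <= ln 2 :> R.
Proof.
have := @le_ln1Dx R (- (1 / 2)).
have -> : 1 + - (1 / 2) = 2^-1 :> R by field.
by rewrite lnV ?posrE //; lra.
Qed.

Lemma powR_expR (a r : R) : 0 < a -> a `^ r = expR (r * ln a).
Proof. by move=> a_gt0; rewrite /powR gt_eqF. Qed.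

Variables (L alpha : R).
Hypothesis L0 : 0 <= L.
Hypothesis alpha01 : 0 < alpha <= 1.

Let a0 : 0 < alpha. Proof. by case/andP: alpha01. Qed.
Let a1 : alpha <= 1. Proof. by case/andP: alpha01. Qed.
Let a1n : 1 + alpha != 0. Proof. by rewrite lt0r_neq0 // addr_gt0. Qed.

Lemma JB_M_gt0 T : (0 < JB_M L alpha T)%N.
Proof. by rewrite /JB_M; case: ifP => // _; rewrite leq_max. Qed.

Let y := L * powR 2 (alpha / 2).
Let y0 : 0 <= y. Proof. by rewrite mulr_ge0 // powR_ge0. Qed.
Let c0 := powR y (1 / (1 + alpha)).

Definition JB_rate (t : R) := powR t ((alpha + 2) / (2 * (alpha + 1)))
  * powR (ln t) (alpha / (2 * (alpha + 1))).

Variable T : nat.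
Hypothesis T2 : (2 <= T)%N.
Let t : R := T%:R.
Let t2 : 2 <= t. Proof. by rewrite /t ler_nat. Qed.
Let t0 : 0 < t. Proof. by have := t2; lra. Qed.
Let lt2 : 1 / 2 <= ln t.
Proof. by apply: le_trans ln2_ge_half _; rewrite ler_ln ?posrE. Qed.
Let lt0 : 0 < ln t. Proof. by have := lt2; lra. Qed.
Let S := Num.sqrt (t * ln t).
Let x := (Num.sqrt (t / ln t) * L * powR 2 (alpha / 2)) `^ (1 / (1 + alpha)).
Let M := JB_M L alpha T.

Lemma epoch_scale_ge1 : 1 <= S.
Proof.
rewrite -[leLHS]sqrtr1 ler_wsqrtr //.
by apply: (@le_trans _ _ (2 * (1 / 2))); [lra|apply: ler_pM => //; lra].
Qed.

Let x0 : 0 <= x. Proof. exact: powR_ge0. Qed.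

Lemma JB_M_bounds : x <= M%:R <= x + 1.
Proof.
have ME : M = maxn 1 (absz (Num.ceil x)).
  by rewrite /M /JB_M gtn_eqF.
have cx0 : (0 <= Num.ceil x)%R by rewrite ceil_ge0 (lt_le_trans _ x0) // ltrN10.
have ceilE : (absz (Num.ceil x))%:R = (Num.ceil x)%:~R :> R.
  by rewrite -{2}(gez0_abs cx0) -pmulrn.
have xc : x <= (absz (Num.ceil x))%:R by rewrite ceilE ceil_ge.
have cx : (absz (Num.ceil x))%:R < x + 1.
  by rewrite ceilE -ltrBlDr; have := ceilB1_lt x; rewrite intrB mulr1z.
rewrite ME; case: (leqP 1 (absz (Num.ceil x))) => h.
  by rewrite xc ltW.
have : (absz (Num.ceil x))%:R <= 1 :> R by rewrite -[leRHS]/(1%:R) ler_nat ltnW.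
by move=> A1; rewrite (le_trans xc A1) lerDr.
Qed.

Let Mr1 : 1 <= M%:R :> R. Proof. by rewrite ler1n JB_M_gt0. Qed.

Let xE : x = powR (t / ln t) (1 / (1 + alpha) / 2) * c0.
Proof.
rewrite /x -mulrA -/y (powRM _ (sqrtr_ge0 _) y0) -powR12_sqrt ?divr_ge0 ?ltW //.
by rewrite -powRrM; congr (powR _ _ * _); field.
Qed.

(** The exponents of the rate are [1 / 2 + g] and [1 / 2 - g] with [g = 1 / (2 (alpha + 1))], so the
    rate is [S] times a nonnegative power of [t / ln t >= 1]. *)
Lemma epoch_scale_le_rate : S <= JB_rate t.
Proof.
have lt_le : ln t <= t by apply: ltW; exact: ln_sublinear.
have tl0 : 0 < t * ln t by exact: mulr_gt0.
rewrite /S -(powR12_sqrt (ltW tl0)) /JB_rate !powR_expR // -expRD ler_expR lnM ?posrE //.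
have h : ln (ln t) <= ln t by rewrite ler_ln ?posrE.
have g0 : 0 <= (alpha + 1)^-1 / 2 by rewrite divr_ge0 // invr_ge0; have := a0; lra.
have := mulr_ge0 g0 (_ : 0 <= ln t - ln (ln t)); rewrite subr_ge0 h => /(_ isT).
have -> : (alpha + 2) / (2 * (alpha + 1)) = 1 / 2 + (alpha + 1)^-1 / 2.
  by field; rewrite addrC.
have -> : alpha / (2 * (alpha + 1)) = 1 / 2 - (alpha + 1)^-1 / 2.
  by field; rewrite addrC.
set g := _ / 2; set u := ln t; set v := ln u; nra.
Qed.

(** Origin of the exponents in the theorem: UCB1 costs about [S] times the grid parameter, which is
    about [x]. *)
Lemma epoch_scale_mul_x : S * x = c0 * JB_rate t.
Proof.
rewrite xE mulrA [RHS]mulrC; congr (_ * _).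
have tl0 : 0 < t * ln t by exact: mulr_gt0.
rewrite /S -(powR12_sqrt (ltW tl0)) /JB_rate !powR_expR ?divr_gt0 //.
rewrite -!expRD; congr expR; rewrite lnM ?posrE // ln_div ?posrE //.
by field; rewrite ?a1n // addrC a1n.
Qed.

(** The value [x] solves the balance equation: [x ^ (1 + alpha) = sqrt (t / ln t) * y] and
    [t = S * sqrt (t / ln t)] give [t * y / x ^ alpha = S * x]. The case [y = 0] is separate because
    [x] is then 0. *)
Lemma discretization_le : t * (L * powR (Num.sqrt 2 / M%:R) alpha) <= S * x.
Proof.
have M0 : 0 < M%:R :> R by have := Mr1; lra.
have -> : L * powR (Num.sqrt 2 / M%:R) alpha = y / powR M%:R alpha.
  rewrite powRM ?sqrtr_ge0 ?invr_ge0 ?ltW // -powR12_sqrt // -powRrM mulrA.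
  rewrite /y; congr (_ * powR _ _ * _); first by field.
  by rewrite -(powR_inv1 (ltW M0)) -powRrM mulN1r powRN.
have [yz|yn] := eqVneq y 0; first by rewrite yz mul0r mulr0 mulr_ge0 // sqrtr_ge0.
have yp : 0 < y by rewrite lt_def yn.
have sp : 0 < Num.sqrt (t / ln t) by rewrite sqrtr_gt0 divr_gt0.
have xp : 0 < x by rewrite /x powR_gt0 // -mulrA mulr_gt0.
have xaE : powR x (1 + alpha) = Num.sqrt (t / ln t) * y.
  rewrite /x -powRrM -mulrA -/y; have -> : 1 / (1 + alpha) * (1 + alpha) = 1 by field.
  by rewrite powRr1 // mulr_ge0 // ltW.
have xap : 0 < powR x alpha by exact: powR_gt0.
have xM : powR x alpha <= powR M%:R alpha.
  by apply: ge0_ler_powR; rewrite ?nnegrE ?(ltW a0) ?x0 ?(ltW M0) //; case/andP: JB_M_bounds.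
apply: (@le_trans _ _ (t * (y / powR x alpha))).
  apply: ler_wpM2l; first exact: ltW.
  by apply: ler_wpM2l => //; rewrite lef_pV2 ?posrE // (lt_le_trans xap).
have -> : t = S * Num.sqrt (t / ln t).
  rewrite /S -sqrtrM ?mulr_ge0 ?ltW //.
  have -> : t * ln t * (t / ln t) = t ^+ 2 by field; rewrite lt0r_neq0.
  by rewrite sqrtr_sqr ger0_norm // ltW.
rewrite -[leLHS]mulrA ler_wpM2l ?sqrtr_ge0 // mulrA -xaE powRD; last first.
  by apply/implyP => _; rewrite gt_eqF.
by rewrite mulfK ?gt_eqF // powRr1 // ltW.
Qed.

Lemma epoch_bound (N m : nat) (D : R) : (0 < N)%N -> (m <= T)%N ->
  let K := (N * M * M)%N in
  D <= m%:R -> D <= m%:R * (L * powR (Num.sqrt 2 / M%:R) alpha)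
    + (K%:R + 6 * Num.sqrt (2 * ln t) * Num.sqrt (K%:R * m%:R) + 4) ->
  D <= (16 * c0 + 15) * N%:R * JB_rate t.
Proof.
move=> N0 mT K Dm DK.
have N1 : 1 <= N%:R :> R by rewrite ler1n.
have K1 : 1 <= K%:R :> R by rewrite ler1n !muln_gt0 N0 JB_M_gt0.
have mt : m%:R <= t by rewrite ler_nat.
have S1 := epoch_scale_ge1.
pose sK : R := Num.sqrt K%:R.
have sK1 : 1 <= sK by rewrite -[leLHS]sqrtr1 ler_wsqrtr.
(* Here the dependence on the number of schemes becomes linear: [sqrt (N M^2) <= N * M]. *)
have sKM : sK <= N%:R * (x + 1).
  apply: (@le_trans _ _ (N%:R * M%:R)); last first.
    by rewrite ler_wpM2l //; case/andP: JB_M_bounds.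
  have MN0 : 0 <= N%:R * M%:R :> R by rewrite mulr_ge0.
  rewrite -(ger0_norm MN0) -sqrtr_sqr ler_wsqrtr // /K !natrM exprMn expr2.
  by rewrite -mulrA -expr2 ler_wpM2r ?sqr_ge0 // ler_peMr.
have st : Num.sqrt t <= 2 * S.
  have -> : 2 * S = Num.sqrt (4 * (t * ln t)).
    rewrite sqrtrM // (_ : 4 = 2 ^+ 2 :> R) ?sqrtr_sqr ?ger0_norm //.
    by rewrite expr2; ring.
  rewrite ler_wsqrtr // mulrCA -[leLHS]mulr1.
  by apply: ler_wpM2l; [exact: ltW|have := lt2; lra].
have cK0 : 0 <= sK * S by rewrite mulr_ge0 // sqrtr_ge0.
(* The 15 is made of 2 from the initial plays, 9 from [6 * sqrt 2 <= 6 * (3 / 2)], and 4 from the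
   bad events, each times [sK * S]. *)
have main : D <= S * x + 15 * (sK * S).
  have Sx0 : 0 <= S * x by rewrite mulr_ge0 // sqrtr_ge0.
  (* With more arms than steps the UCB1 bound is useless, but then [t <= sqrt t * sK] and the
     trivial bound suffices. *)
  have [KT|TK] := leP K%:R t; last first.
    apply: (le_trans Dm); apply: (le_trans mt).
    have -> : t = Num.sqrt t * Num.sqrt t by rewrite -expr2 sqr_sqrtr // ltW.
    have : Num.sqrt t * Num.sqrt t <= sK * (2 * S).
      by apply: ler_pM; rewrite ?sqrtr_ge0 // ler_wsqrtr // ltW.
    lra.
  apply: (le_trans DK); apply: lerD.
    apply: le_trans discretization_le; rewrite ler_wpM2r // mulr_ge0 ?powR_ge0 //.
  have h1 : K%:R <= 2 * (sK * S).
    have -> : K%:R = sK * sK by rewrite -expr2 sqr_sqrtr.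
    rewrite [leRHS]mulrCA; apply: ler_wpM2l; first exact: sqrtr_ge0.
    by apply: le_trans st; exact: ler_wsqrtr.
  have h2 : Num.sqrt (2 * ln t) * Num.sqrt (K%:R * m%:R) <= Num.sqrt 2 * (sK * S).
    have -> : Num.sqrt 2 * (sK * S) = Num.sqrt (2 * (K%:R * (t * ln t))).
      by rewrite [RHS]sqrtrM // [X in _ = _ * X]sqrtrM.
    rewrite -sqrtrM; last by rewrite mulr_ge0 // ltW.
    apply: ler_wsqrtr.
    have -> : 2 * ln t * (K%:R * m%:R) = 2 * K%:R * ln t * m%:R by ring.
    have -> : 2 * (K%:R * (t * ln t)) = 2 * K%:R * ln t * t by ring.
    by apply: ler_wpM2l => //; rewrite mulr_ge0 ?mulr_ge0 // ltW.
  have h3 : Num.sqrt 2 <= 3 / 2 :> R.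
    have h : 0 <= 3 / 2 :> R by lra.
    by rewrite -(ger0_norm h) -sqrtr_sqr ler_wsqrtr // expr2; lra.
  have h4 : Num.sqrt 2 * (sK * S) <= 3 / 2 * (sK * S) by rewrite ler_wpM2r.
  have h5 : 1 <= sK * S by rewrite -[leLHS]mulr1 ler_pM.
  have h6 : 6 * Num.sqrt (2 * ln t) * Num.sqrt (K%:R * m%:R) =
    6 * (Num.sqrt (2 * ln t) * Num.sqrt (K%:R * m%:R)) by rewrite mulrA.
  rewrite h6; lra.
apply: (le_trans main).
have Sx0 : 0 <= S * x by rewrite mulr_ge0 // sqrtr_ge0.
have S0 : 0 <= S by exact: sqrtr_ge0.
apply: (@le_trans _ _ (N%:R * (16 * (S * x) + 15 * S))).
  have e1 : sK * S <= N%:R * (x + 1) * S by rewrite ler_wpM2r.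
  have e2 : S * x <= N%:R * (S * x) by rewrite ler_peMl.
  lra.
rewrite epoch_scale_mul_x.
have e3 := epoch_scale_le_rate.
rewrite [leRHS](_ : _ = N%:R * (16 * (c0 * JB_rate t) + 15 * JB_rate t)); last by ring.
by rewrite ler_wpM2l // lerD2l ler_wpM2l.
Qed.
End EpochBound.

(** * JB as a succession of UCB1 runs *)

Section JBLink.
Context d (Omega : measurableType d) (R : realType).
Variables (J P : finType) (V : nat -> Omega -> P).
Variables (C : nat -> P -> J -> R * R -> Omega -> R) (L alpha : R).

Lemma epoch_histE T k w : let M := JB_M L alpha T in
  epoch_hist V C L alpha T k w =
  ucb_hist J M (fun v a => obs_reward V C (T + v) (grid_arm R J M a) w) k.
Proof. by move=> M; elim: k => //= k ->. Qed.

Lemma JB_playE e u w : (u < 2 ^ e)%N -> let M := JB_M L alpha (2 ^ e) in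
  JB_play V C L alpha (2 ^ e + u) w =
  grid_arm R J M (epoch_arm V C M (2 ^ e) u w).
Proof.
move=> ue M; have -> : JB_play V C L alpha (2 ^ e + u) w = let T := (2 ^ e)%N in
    grid_arm R J M (ucb_choice J M (epoch_hist V C L alpha T (2 ^ e + u - T) w)).
  rewrite /JB_play (@trunc_log_eq 2 e) // leq_addr /=.
  by rewrite expnS mul2n -addnn ltn_add2l.
by rewrite /= addKn epoch_histE.
Qed.
End JBLink.

(** * Distance to the grid *)

Section GridApproximation.
Variable R : realType.

Lemma grid_point_near (x : R) M : 0 <= x <= 1 -> (0 < M)%N ->
  exists2 a, (a < M)%N & `|x - a.+1%:R / M%:R| <= M%:R^-1.
Proof.
move=> /andP[x0 x1] M0; have Mr : 0 < M%:R :> R by rewrite ltr0n.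
have exa : exists a, x * M%:R <= a.+1%:R by exists M.-1; rewrite prednK // ler_piMl // ltW.
(* [a.+1] is [x * M] rounded up, except that [x = 0] goes to the first point [1 / M], the grid
   having no point 0. *)
case: (ex_minnP exa) => a xa amin; exists a.
  have := amin M.-1; rewrite prednK // ler_piMl ?(ltW Mr) // => /(_ isT).
  by rewrite -ltnS prednK.
have ax : a%:R <= x * M%:R.
  case: a amin {xa} => [|a] amin; first by rewrite mulr_ge0 // ltW.
  by rewrite leNgt; apply/negP => /ltW /amin; rewrite ltnn.
have -> : x - a.+1%:R / M%:R = - (a.+1%:R - x * M%:R) / M%:R.
  by field; rewrite lt0r_neq0.
rewrite normrM normrN normfV (gtr0_norm Mr) ger0_norm ?subr_ge0 //.
by rewrite -[leRHS]mul1r ler_wpM2r ?invr_ge0 ?(ltW Mr) // -natr1; lra.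
Qed.

Lemma dist2_le (s s' : R * R) (c : R) : 0 <= c ->
  `|s.1 - s'.1| <= c -> `|s.2 - s'.2| <= c -> dist2 s s' <= Num.sqrt 2 * c.
Proof.
move=> c0 h1 h2; rewrite /dist2 -[X in _ * X](ger0_norm c0) -sqrtr_sqr -sqrtrM //.
apply: ler_wsqrtr; rewrite mulr2n mulrDl mul1r.
by apply: lerD; rewrite -real_normK ?num_real // lerXn2r ?nnegrE.
Qed.
End GridApproximation.

(** The horizon usually cuts the last block, which is why the hypothesis bounds every initial piece
    of a block. *)
Lemma sum_dyadic_le (R : realType) (f B : nat -> R) n : (0 < n)%N ->
  (forall e m, (m <= 2 ^ e)%N -> \sum_(0 <= u < m) f (2 ^ e + u)%N <= B e) ->
  \sum_(1 <= t < n.+1) f t <= \sum_(e < (trunc_log 2 n).+1) B e.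
Proof.
move=> n0 fB.
have block e m : (m <= 2 ^ e)%N ->
    \sum_(1 <= t < 2 ^ e + m) f t <= \sum_(1 <= t < 2 ^ e) f t + B e.
  move=> me; rewrite (@big_cat_nat _ _ _ (2 ^ e)) ?expn_gt0 ?leq_addr //= lerD2l.
  apply: le_trans (fB e m me).
  by rewrite -{1}[(2 ^ e)%N]add0n [(2 ^ e + m)%N]addnC big_addn addnK;
    under eq_bigr do rewrite addnC.
have full e : \sum_(1 <= t < 2 ^ e) f t <= \sum_(i < e) B i.
  elim: e => [|e IH]; first by rewrite big_geq // big_ord0.
  rewrite expnS mul2n -addnn big_ord_recr /=.
  by apply: le_trans (block e _ (leqnn _)) _; rewrite lerD2r.
have /andP[en ne] := trunc_log_bounds (isT : (1 < 2)%N) n0.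
rewrite -(subnKC (leq_trans en (leqnSn n))) big_ord_recr /=.
apply: le_trans (block _ _ _) _; last by rewrite lerD2r.
by rewrite leq_subLR addnn -mul2n -expnS.
Qed.

Lemma geometric_le (R : realType) (q : R) e : 1 < q ->
  \sum_(i < e.+1) q ^+ i <= q / (q - 1) * q ^+ e.
Proof.
move=> q1; have q0 : 0 < q - 1 by rewrite subr_gt0.
rewrite mulrAC ler_pdivlMr // mulrC -subrX1 exprS.
by rewrite gerBl.
Qed.

(** * Summing the epoch bounds *)

Section RateSum.
Variables (R : realType) (alpha : R).
Hypothesis alpha01 : 0 < alpha <= 1.
Let beta := (alpha + 2) / (2 * (alpha + 1)).
Let gamma := alpha / (2 * (alpha + 1)).

Let a0 : 0 < alpha. Proof. by case/andP: alpha01. Qed.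
Let beta0 : 0 < beta.
Proof. by rewrite divr_gt0 // ?mulr_gt0 //; have := a0; lra. Qed.
Let gamma0 : 0 <= gamma.
Proof. by rewrite divr_ge0 // ?mulr_ge0 //; have := a0; lra. Qed.
Let gamma1 : gamma <= 1.
Proof. by rewrite ler_pdivrMr ?mulr_gt0 //; have := a0; lra. Qed.

Let q : R := powR 2 beta.
Definition geometric_const := q / (q - 1).

Let q1 : 1 < q.
Proof. by rewrite /q powR_expR // expR_gt1 mulr_gt0 // ln_gt0 // ltr1n. Qed.

Let qX e : q ^+ e = powR (2 ^ e)%:R beta.
Proof. by rewrite -powR_mulrn ?powR_ge0 // natrX -powR_mulrn // -!powRrM mulrC. Qed.

Lemma ln_nat_ge_half n : (2 <= n)%N -> 1 / 2 <= ln n%:R :> R.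
Proof.
move=> n2; apply: le_trans (ln2_ge_half R) _.
by rewrite ler_ln ?posrE ?ler_nat // ltr0n (leq_trans _ n2).
Qed.

(** Every logarithmic factor is bounded by the one at [n], which leaves a geometric sum of ratio
    [2 ^ beta > 1]. The rate vanishes at [T = 1], so epoch 0 is bounded by 1 and absorbed through
    [c >= 2] and [g >= 1 / 2]. *)
Lemma sum_rate_le (c : R) n (B : nat -> R) : 2 <= c -> (2 <= n)%N -> B 0%N <= 1 ->
  (forall e, (0 < e)%N -> B e <= c * JB_rate alpha (2 ^ e)%:R) ->
  \sum_(e < (trunc_log 2 n).+1) B e <= c * geometric_const * JB_rate alpha n%:R.
Proof.
move=> c2 n2 B0 Be; have n0 : (0 < n)%N by exact: leq_trans n2.
have c0 : 0 <= c by lra.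
have lnn := ln_nat_ge_half n2.
have ln0 : 0 < ln n%:R :> R by lra.
pose g := powR (ln n%:R : R) gamma.
(* If [ln n < 1], the power is still at least 1/2, since [ln n >= 1 / 2] and the exponent [gamma] is
   at most 1. *)
have g12 : 1 / 2 <= g.
  have h : 0 < 1 / 2 :> R by lra.
  rewrite /g powR_expR // -[leLHS]lnK ?posrE // ler_expR.
  have h2 : ln (1 / 2) <= 0 :> R by apply: ln_le0; lra.
  have h3 : ln (1 / 2) <= ln (ln n%:R) :> R by rewrite ler_ln ?posrE.
  have [l0|l0] := leP 0 (ln (ln n%:R : R)); first by apply: le_trans h2 _; rewrite mulr_ge0.
  apply: le_trans h3 _; rewrite -[leLHS]mul1r; apply: ler_wnM2r => //; exact: ltW.
have g0 : 0 <= g by lra.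
have /andP[en _] := trunc_log_bounds (isT : (1 < 2)%N) n0.
apply: (@le_trans _ _ (\sum_(e < (trunc_log 2 n).+1) c * g * q ^+ e)).
  apply: ler_sum => -[e /= elt] _; case: e elt => [|e] elt.
    by rewrite expr0 mulr1; apply: (le_trans B0); have := ler_pM (ler0n R 2) _ c2 g12; lra.
  apply: (le_trans (Be e.+1 isT)); rewrite -mulrA; apply: ler_wpM2l => //.
  rewrite qX mulrC /JB_rate; apply: ler_wpM2l; first exact: powR_ge0.
  have e2 : (2 <= 2 ^ e.+1)%N by rewrite expnS leq_pmulr // expn_gt0.
  have le0 := ln_nat_ge_half e2.
  apply: ge0_ler_powR; rewrite ?nnegrE //; [by lra|exact: ltW|].
  rewrite ler_ln ?posrE ?ltr0n ?expn_gt0 // ler_nat.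
  by apply: leq_trans en; rewrite leq_exp2l.
rewrite -mulr_sumr; have cg0 : 0 <= c * g by exact: mulr_ge0.
apply: le_trans (ler_wpM2l cg0 (geometric_le _ q1)) _.
rewrite /JB_rate -/beta -/gamma -/g -/geometric_const.
have gc0 : 0 <= geometric_const.
  by rewrite divr_ge0 // ?subr_ge0 ltW // (lt_trans _ q1).
rewrite [leLHS](_ : _ = c * geometric_const * (q ^+ trunc_log 2 n * g)); last by ring.
apply: ler_wpM2l; first exact: mulr_ge0.
apply: ler_wpM2r => //; rewrite qX.
by apply: ge0_ler_powR; rewrite ?nnegrE ?ler0n ?ler_nat // ltW.
Qed.
End RateSum.

(** A single grid point near [sstar] serves all victim strategies, as [L] and [alpha] are common to
    them; averaging with the weights [p] keeps the bound. *)
Lemma discretization_error (R : realType) (J P : finType) (Cbar : P -> J -> R * R -> R)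
    (p : P -> R) (L alpha : R) (jstar : J) (sstar : R * R) (M : nat) :
  0 <= L -> 0 < alpha -> (forall i, 0 <= p i) -> \sum_(i : P) p i = 1 ->
  (forall i j s s', unit_box s -> unit_box s' ->
     `|Cbar i j s - Cbar i j s'| <= L * powR (dist2 s s') alpha) ->
  unit_box sstar -> (0 < M)%N ->
  exists2 k, (k < nb_arms J M)%N &
    arm_mean Cbar p (Some (jstar, sstar)) - arm_mean Cbar p (grid_arm R J M k)
    <= L * powR (Num.sqrt 2 / M%:R) alpha.
Proof.
move=> L0 a0 p0 p1 holder [s1 s2] M0.
have [a aM ha] := grid_point_near s1 M0; have [b bM hb] := grid_point_near s2 M0.
have [k kK Ek] := grid_arm_surj R jstar aM bM; exists k => //.
have us' : unit_box (a.+1%:R / M%:R, b.+1%:R / M%:R : R).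
  by have [j [s []]] := grid_arm_valid R kK; rewrite Ek => -[_ <-].
have usstar : unit_box sstar by [].
have -> : L * powR (Num.sqrt 2 / M%:R) alpha =
    \sum_(i : P) p i * (L * powR (Num.sqrt 2 / M%:R) alpha).
  by rewrite -mulr_suml p1 mul1r.
rewrite Ek /arm_mean -sumrB; apply: ler_sum => i _.
rewrite -mulrBr; apply: ler_wpM2l => //; apply: le_trans (ler_norm _) _.
apply: le_trans (holder _ _ _ _ usstar us') _; apply: ler_wpM2l => //.
have Mr : 0 <= M%:R^-1 :> R by rewrite invr_ge0.
apply: ge0_ler_powR; rewrite ?nnegrE ?(ltW a0) ?sqrtr_ge0 ?mulr_ge0 ?sqrtr_ge0 //.
exact: dist2_le.
Qed.

(** * The regret bound for JB *)

Theorem theorem6 (R : realType) (L alpha : R) :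
  0 <= L -> 0 < alpha <= 1 ->
  exists K : R,
  forall (J P : finType) (d : measure_display) (Omega : measurableType d)
    (Pr : probability Omega R)
    (V : nat -> Omega -> P) (C : nat -> P -> J -> R * R -> Omega -> R)
    (Cbar : P -> J -> R * R -> R) (p : P -> R)
    (jstar : J) (sstar : R * R),
  (* victim's distribution, unknown to the jammer *)
  (forall i, 0 <= p i) -> \sum_(i : P) p i = 1 ->
  (forall t, (0 < t)%N -> forall i, measurable (V t @^-1` [set i])) ->
  (forall t, (0 < t)%N -> forall i, prob Pr (V t @^-1` [set i]) = p i) ->
  (* rewards in [0,1], measurable *)
  (forall t i j s, (0 < t)%N -> unit_box s ->
     measurable_fun setT (C t i j s) /\
     forall w, 0 <= C t i j s w <= 1) ->
  (* identically distributed over time, with mean Cbar *)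
  (forall t i j s (B : set R), (0 < t)%N -> unit_box s -> measurable B ->
     prob Pr (C t i j s @^-1` B) = prob Pr (C 1 i j s @^-1` B)) ->
  (forall t i j s, (0 < t)%N -> unit_box s ->
     (\int[Pr]_w (C t i j s w)%:E = (Cbar i j s)%:E)%E) ->
  (* independence over time, and of the victim's choices *)
  mutually_independent Pr (time_blocks V C) ->
  (* Hoelder continuity of the mean rewards *)
  (forall i j s s', unit_box s -> unit_box s' ->
     `|Cbar i j s - Cbar i j s'| <= L * powR (dist2 s s') alpha) ->
  (* (jstar, sstar) maximizes sum_i p_i Cbar^i *)
  unit_box sstar ->
  (forall j s, unit_box s ->
     \sum_(i : P) p i * Cbar i j s <= \sum_(i : P) p i * Cbar i jstar sstar) ->
  forall n : nat, (2 <= n)%N ->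
  (\int[Pr]_w (JB_regret_integrand V C L alpha p n jstar sstar w)%:E
   <= (K * #|J|%:R * powR n%:R ((alpha + 2) / (2 * (alpha + 1)))
        * powR (ln n%:R) (alpha / (2 * (alpha + 1))))%:E)%E.

Proof.
move=> L0 alpha01; have /andP[a0 a1] := alpha01.
pose c0 := powR (L * powR 2 (alpha / 2)) (1 / (1 + alpha)).
pose c := 16 * c0 + 15.
have c2 : 2 <= c by have : 0 <= c0 := powR_ge0 _ _; rewrite /c; lra.
exists (c * geometric_const alpha).
move=> J P d Omega Pr V C Cbar p jstar sstar p0 p1 VM Vp CM _ Cmean VCind holder
  usstar maxstar n n2.
pose r e u := epoch_mean_regret Pr V C p (JB_M L alpha (2 ^ e)) (2 ^ e) jstar sstar u.
(* [f] glues the expected step regrets of all epochs into one function of absolute time. *)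
pose f t := let e := trunc_log 2 t in r e (t - 2 ^ e)%N.
have J1 : (0 < #|J|)%N by apply/card_gt0P; exists jstar.
have M0 e : (0 < JB_M L alpha (2 ^ e))%N by exact: JB_M_gt0.
have T0 e : (0 < 2 ^ e)%N by rewrite expn_gt0.
have K0 e : (0 < nb_arms J (JB_M L alpha (2 ^ e)))%N.
  by rewrite /nb_arms !muln_gt0 J1 M0.
have fE e u : (u < 2 ^ e)%N -> f (2 ^ e + u)%N = r e u.
  move=> ue; rewrite /f (@trunc_log_eq 2 e) ?leq_addr //= ?addKn //.
  by rewrite expnS mul2n -addnn ltn_add2l.
pose G t w := \sum_(i : P) p i * (C t i jstar sstar w -
  (if JB_play V C L alpha t w is Some (j, s) then C t i j s w else 0)).
have GE t : (0 < t)%N -> let e := trunc_log 2 t in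
    G t = epoch_step_regret V C p (JB_M L alpha (2 ^ e)) (2 ^ e) jstar sstar (t - 2 ^ e).
  move=> t0 e; have /andP[et te] := trunc_log_bounds (isT : (1 < 2)%N) t0.
  apply/funext => w; rewrite /G -{1 2 3}(subnKC et) JB_playE //.
  by rewrite ltn_subLR // addnn -mul2n -expnS.
have Gint t : Pr.-integrable setT (EFin \o G t.+1).
  rewrite GE //.
  exact: (integrable_epoch_step_regret Pr Cbar p0 p1 VM CM (T0 _) (K0 _) jstar usstar).
have Gmean t : (\int[Pr]_w (G t.+1 w)%:E = (f t.+1)%:E)%E.
  rewrite GE //; exact: (epoch_mean_regretE Pr Cbar p0 p1 VM CM (T0 _) (K0 _) jstar usstar).
have -> : (\int[Pr]_w (JB_regret_integrand V C L alpha p n jstar sstar w)%:E =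
    (\sum_(1 <= t < n.+1) f t)%:E)%E.
  rewrite big_add1 /= -sumEFin; under [RHS]eq_bigr do rewrite -Gmean.
  rewrite -integral_sum //.
  by apply: eq_integral => w _; rewrite sumEFin /JB_regret_integrand big_add1.
rewrite lee_fin.
have N1 : 1 <= #|J|%:R :> R by rewrite ler1n.
have cN : 2 <= c * #|J|%:R.
  by apply: (le_trans c2); rewrite ler_peMr //; lra.
(* Epoch 0 consists of the single time 1, where the rate is 0; the trivial bound 1 is used
   instead. *)
pose B e : R := if e == 0%N then 1 else c * #|J|%:R * JB_rate alpha (2 ^ e)%:R.
have rle1 e u : r e u <= 1.
  exact: (epoch_mean_regret_le1 Pr Cbar p0 p1 VM CM (T0 e) (K0 e) jstar usstar).
apply: le_trans (@sum_dyadic_le _ f B n _ _) _.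
- exact: leq_trans n2.
- move=> e m me.
  have -> : \sum_(0 <= u < m) f (2 ^ e + u)%N = \sum_(0 <= u < m) r e u.
    by rewrite big_nat [RHS]big_nat; apply: eq_bigr => u /andP[_ um]; rewrite fE // (leq_trans um).
  have Dm : \sum_(0 <= u < m) r e u <= m%:R.
    apply: le_trans (ler_sum _ (fun u _ => rle1 e u)) _.
    by rewrite big_const_nat subn0 iter_addr addr0.
  case: e me Dm => [|e] me Dm /=.
    by apply: (le_trans Dm); rewrite -[leRHS]/(1%:R) ler_nat.
  have e2 : (2 <= 2 ^ e.+1)%N by rewrite expnS leq_pmulr.
  apply: (epoch_bound L0 alpha01 e2 J1 me Dm).
  have [k kK kd] := discretization_error jstar L0 a0 p0 p1 holder usstar (M0 e.+1).
  apply: le_trans (epoch_regret p0 p1 VM Vp CM Cmean VCind (T0 _) (K0 _) jstar usstar me kK) _.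
  by rewrite lerD2r; apply: ler_wpM2l.
have B0 : B 0%N <= 1 by [].
have Be e : (0 < e)%N -> B e <= c * #|J|%:R * JB_rate alpha (2 ^ e)%:R.
  by rewrite /B; case: e.
apply: le_trans (sum_rate_le alpha01 cN n2 B0 Be) _.
by rewrite /JB_rate le_eqVlt; apply/orP; left; apply/eqP; ring.
Qed.
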